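(* Let $M$ be a compact topological manifold supporting a Borel probability measure $\mu$. Consider a family of embeddings of $M$ into Euclidean spaces ${\mathbf R}^d$, $d\to\infty$, as a submanifold, such that for each $\varepsilon>0$ the Euclidean covering numbers $N(M,\varepsilon)$ of the image grow as $o(d)$. Let $\sigma=\sigma(d)=O(1/\sqrt d)$ and let $\gamma_d(0,\sigma^2)$ be the centered Gaussian measure on ${\mathbf R}^d$ with covariance $\sigma^2 I_d$. Then the Gromov distance between the image of $(M,\mu)$ in ${\mathbf R}^d$ (with the Euclidean distance and the push-forward of $\mu$) and its corruption $({\mathbf R}^d,\|\cdot\|,\mu\ast\gamma_d(0,\sigma^2))$ tends to zero as $d\to\infty$.
   Context: $N(M,\varepsilon)$ is the smallest number of open Euclidean balls of radius $\varepsilon$ covering $M$. $\mu\ast\gamma_d$ denotes convolution of measures on ${\mathbf R}^d$ (the $mm$-space ''corruption'' of $(M,\mu)$ by Gaussian noise). For a metric space with Borel probability measure $(X,d,\mu)$: ${\mathrm{Lip}}_1(X)$ is the set of real-valued 1-Lipschitz functions; a parametrization is a measurable $\phi\colon[0,1]\to X$ with $\mu(A)=\lambda(\phi^{-1}(A))$ for all Borel $A$. For measurable $f,g$ on $[0,1]$, ${\mathrm{me}}_1(f,g)=\inf\{\varepsilon>0\colon \lambda\{t\colon |f(t)-g(t)|>\varepsilon\}<\varepsilon\}$. The Gromov distance $d_{conc}(X,Y)$ is the infimum of all $\varepsilon>0$ for which there exist parametrizations $\phi_X,\phi_Y$ such that every $f\in{\mathrm{Lip}}_1(X)$ has some $g\in{\mathrm{Lip}}_1(Y)$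 with ${\mathrm{me}}_1(f\circ\phi_X,g\circ\phi_Y)<\varepsilon$, and vice versa. *)

(* Defs.v *)
From HB Require Import structures.
From mathcomp Require Import all_boot all_order all_algebra.
From mathcomp Require Import all_classical all_reals all_analysis.
Set Implicit Arguments. Unset Strict Implicit. Unset Printing Implicit Defensive.
Import Order.TTheory GRing.Theory Num.Theory.
Local Open Scope classical_set_scope.
Local Open Scope ring_scope.

Section Defs.
Context {R : realType}.

(* n.-tuple R carries the product sigma-algebra of Borel sets of R
   (library instance measure_tuple_display), i.e. the Borel sets of R^n. *)

Definition eucl n (x y : n.-tuple R) : R :=
  Num.sqrt (\sum_(i < n) (tnth x i - tnth y i) ^+ 2).

Definition tadd n (x y : n.-tuple R) : n.-tuple R :=
  [tuple tnth x i + tnth y i | i < n].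

Definition eucl_open n (V : set (n.-tuple R)) : Prop :=
  forall x, V x -> exists2 e : R, 0 < e & forall y, eucl x y < e -> V y.

Definition chart (T : topologicalType) k (U : set T) (h : T -> k.-tuple R) :=
  [/\ open U,
      (forall x y, U x -> U y -> h x = h y -> x = y),
      eucl_open (h @` U),
      (forall x, U x -> forall e : R, 0 < e ->
          \forall y \near x, U y -> eucl (h x) (h y) < e) &
      (forall x, U x -> forall W, nbhs x W ->
          exists2 e : R, 0 < e & forall y, U y -> eucl (h x) (h y) < e -> W y)].

Definition topological_manifold (T : topologicalType) : Prop :=
  [/\ hausdorff_space T,
      (exists B : set (set T), [/\ countable B, (forall b, B b -> open b) &
          forall x W, nbhs x W -> exists b, [/\ B b, b x & b `<=` W]]) &
      exists k : nat, forall x : T, exists U (h : T -> k.-tuple R),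
          U x /\ chart U h].

Definition embedding (T : topologicalType) n (f : T -> n.-tuple R) : Prop :=
  [/\ injective f,
      (forall x (e : R), 0 < e -> \forall y \near x, eucl (f x) (f y) < e) &
      (forall x W, nbhs x W ->
          exists2 e : R, 0 < e & forall y, eucl (f x) (f y) < e -> W y)].

(* N(A, e): smallest number of open Euclidean balls of radius e covering A
   (+oo if there is no finite cover) *)
Definition covering_number n (A : set (n.-tuple R)) (e : R) : \bar R :=
  ereal_inf [set ((size c)%:R)%:E | c in
    [set c : seq (n.-tuple R) | forall a, A a -> exists2 x, x \in c & eucl x a < e]].

Definition gauss1 (s : R) : set R -> \bar R :=
  if s == 0 then \d_(0 : R) else normal_prob 0 s.

Fixpoint gauss (n : nat) (s : R) : set (n.-tuple R) -> \bar R :=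
  match n with
  | 0 => fun A => (\1_A [tuple] : R)%:E
  | m.+1 => fun A =>
      (\int[gauss1 s]_x (@gauss m s (fun t : m.-tuple R => A (cons_tuple x t))))%E
  end.

Definition convolution n (nu gam : set (n.-tuple R) -> \bar R)
    : set (n.-tuple R) -> \bar R :=
  fun A => (\int[nu]_x gam [set y | A (tadd x y)])%E.

(* The mm-spaces considered are subsets S of R^n with the Euclidean distance
   and a Borel probability measure nu on R^n concentrated on S. *)

Definition parametrization n (S : set (n.-tuple R))
    (nu : set (n.-tuple R) -> \bar R) (phi : R -> n.-tuple R) : Prop :=
  [/\ measurable_fun (`[0%R, 1%R]%classic : set R) phi,
      phi @` (`[0%R, 1%R]%classic : set R) `<=` S &
      forall A : set (n.-tuple R), measurable A ->
        nu A = lebesgue_measure ((`[0%R, 1%R]%classic : set R) `&` phi @^-1` A)].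

Definition Lip1 n (S : set (n.-tuple R)) (g : n.-tuple R -> R) : Prop :=
  forall x y, S x -> S y -> `|g x - g y| <= eucl x y.

Definition me1 (u v : R -> R) : R :=
  inf [set e : R | 0 < e /\
    (lebesgue_measure [set t | (`[0%R, 1%R]%classic : set R) t /\ (e < `|u t - v t|)%R] < e%:E)%E].

Definition dconc n (S1 : set (n.-tuple R)) (nu1 : set (n.-tuple R) -> \bar R)
    (S2 : set (n.-tuple R)) (nu2 : set (n.-tuple R) -> \bar R) : R :=
  inf [set e : R | 0 < e /\ exists phi1 phi2,
    [/\ parametrization S1 nu1 phi1, parametrization S2 nu2 phi2,
        (forall g1, Lip1 S1 g1 ->
           exists2 g2, Lip1 S2 g2 & me1 (g1 \o phi1) (g2 \o phi2) < e) &
        (forall g2, Lip1 S2 g2 ->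
           exists2 g1, Lip1 S1 g1 & me1 (g1 \o phi1) (g2 \o phi2) < e)]].

End Defs.

(* Main.v *)
(* Take X of law mu and an independent Gaussian noise Z, both realized on [0, 1]
   by a Borel encoding followed by a quantile function, and compare X with X + Z.
   - Given g 1-Lipschitz on R^d, let g'(x) = t^-1 ln E exp(t g(x + Z)), which is
     again 1-Lipschitz. Maurey's property (tau), obtained from a one-dimensional
     Prekopa-Leindler inequality by tensorization, gives
     E exp(t g(x + Z)) E exp(- t g(x + Z)) <= exp(t^2 s^2) in every dimension,
     hence |g(X + Z) - g'(X)| is small in probability as s -> 0.
   - Given g 1-Lipschitz on M, extend it to R^d and compose it with the
     orthogonal projection p onto the span of a finite net of M with N = o(d)
     points. Then |p X - X| is small and E |p Z|^2 = O(N sigma^2) = O(N / d), so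
     g(p(X + Z)) is close to g(X) in probability. *)

Require Import Defs.
From HB Require Import structures.
From mathcomp Require Import all_boot all_order all_algebra.
From mathcomp Require Import all_classical all_reals all_analysis.
From mathcomp Require Import measurable_realfun ring lra.
Import Order.TTheory GRing.Theory Num.Theory.
Import numFieldNormedType.Exports.
Local Open Scope classical_set_scope.
Local Open Scope ring_scope.

Set Implicit Arguments. Unset Strict Implicit. Unset Printing Implicit Defensive.

(** * One-dimensional Gaussian inequalities *)

(** The noise itself does not become small: its mean squared norm [d sigma^2] is merely bounded, so
    [X] and [X + Z] can stay at distance of order 1. What becomes small is the centred noise seen by
    a single Lipschitz function, and the noise inside a subspace of dimension o(d). Hence two
    different matchings: a function on the corrupted space is averaged over the noise, a function on
    the clean space is made blind to most of it. The average is exponential because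
    [E exp(t (g(x + Z) - g'(x)))] is then exactly 1, which settles one tail, while the other tail is
    precisely the product estimated by property (tau). The parameter [t] depends on the accuracy [e]
    alone: the tail is at most [2 exp(t^2 s^2 - t e / 2)], so [t] of order [ln(1/e) / e] suffices
    once [s] is so small that [t^2 s^2 <= 1]. The distance asks for one pair of parametrizations
    that serves all Lipschitz functions. So the joint law of [X] and [Z] is realized once, and every
    later estimate is made for a fixed point [x] of the image, uniformly in [x]. *)

Section OneDim.
Context {R : realType}.
Local Notation leb := (@lebesgue_measure R).
Implicit Types (u v w : R -> R) (A B : set R).

(** Tonelli on the region under the graph: vertical sections are [[0, u x[], horizontal ones are the
    superlevel sets. Measurability of the level function is exported because level integrals are
    compared afterwards. *)
Lemma layer_cake u : measurable_fun setT u -> (forall x, 0 <= u x) ->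
  measurable_fun (setT : set R) (fun t : R => leb [set x | t < u x]) /\
  (\int[leb]_x (u x)%:E =
     \int[leb]_(t in `[0%R, +oo[) leb [set x | (t < u x)%R])%E.
Proof.
move=> mu_ u0.
pose E := [set p : R * R | p.2 < u p.1].
have mE : measurable E.
  have -> : E = (fun p : R * R => p.2 < u p.1) @^-1` [set true].
    by apply/seteqP; split.
  rewrite -[X in measurable X]setTI; apply: measurable_fun_ltr => //=.
  exact: measurableT_comp.
have yE t : ysection E t = [set x | t < u x].
  by apply/seteqP; split => x; rewrite /ysection/= inE.
split.
  rewrite (_ : (fun t : R => _) = leb \o ysection E); first exact: measurable_fun_ysection.
  by apply/funext => t /=; rewrite yE.
pose F := E `&` (setT `*` `[0%R, +oo[%classic).
have mF : measurable F.
  by apply: measurableI => //; apply: measurableX => //; exact: measurable_itv.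
have := @indic_fubini_tonelli _ _ _ _ R leb leb F mF.
rewrite indic_fubini_tonelli_FE// indic_fubini_tonelli_GE// => h.
transitivity (\int[leb]_x (leb \o xsection F) x)%E.
  apply: eq_integral => x _ /=.
  have -> : xsection F x = `[0%R, u x[%classic.
    by apply/seteqP; split => t; rewrite /xsection/= inE /F/E/= in_itv/= in_itv/= ?andbT;
      [move=> [-> [_ ->]]| move=> /andP[-> ->]].
  by rewrite lebesgue_measure_itv/= lte_fin; case: ltgtP (u0 x) => // [_|<-] _;
    rewrite ?sube0.
rewrite h [RHS]integral_mkcond; apply: eq_integral => t _ /=.
rewrite patchE; case: ifPn => t0.
  congr leb; rewrite -yE; apply/seteqP; split => x; rewrite /ysection/= !inE /F/=.
    by case.
  by move=> ux; split; [|split; [|exact: set_mem]].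
rewrite (_ : ysection F t = set0) ?measure0//.
rewrite -subset0 => x; rewrite /ysection/= inE /F/= => -[_ [_ t0']].
by move: t0; rewrite notin_setE.
Qed.

Lemma lebesgue_measure_le_diam A : A !=set0 -> has_sup A -> has_inf A ->
  (leb A <= (sup A - inf A)%:E)%E.
Proof.
move=> A0 sA iA.
apply: (@le_trans _ _ (leb `[inf A, sup A]%classic)).
  apply: le_outer_measure => x Ax /=; rewrite in_itv/=.
  by rewrite ge_inf ?ub_le_sup//; [case: sA|case: iA].
have [x Ax] := A0.
have h : inf A <= sup A.
  by apply: (@le_trans _ _ x); [apply: ge_inf => //; case: iA|apply: ub_le_sup => //; case: sA].
rewrite lebesgue_measure_itv/= lte_fin; case: ltP => // h2.
by rewrite lee_fin subr_ge0.
Qed.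

(* One-dimensional Brunn-Minkowski; [c] is the length of a symmetric interval
   containing [A + B]. *)
Lemma brunn_minkowski_interval A B (c : \bar R) : A !=set0 -> B !=set0 ->
  (forall x y, A x -> B y -> ((`|x + y| *+ 2)%:E <= c)%E) ->
  (leb A + leb B <= c)%E.
Proof.
move=> [a Aa] [b Bb] h.
case: c h => [c| |] h; last 2 first.
- by rewrite leey.
- by have := h _ _ Aa Bb.
have hc x y : A x -> B y -> - c / 2 <= x + y <= c / 2.
  move=> Ax By; have := h _ _ Ax By; rewrite lee_fin -[X in X <= _]mulr_natr => h'.
  by rewrite mulNr -ler_norml ler_pdivlMr.
have ubA : ubound A (c / 2 - b) by move=> x Ax; have := hc _ _ Ax Bb; lra.
have lbA : lbound A (- c / 2 - b) by move=> x Ax; have := hc _ _ Ax Bb; lra.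
have ubB : ubound B (c / 2 - a) by move=> x Bx; have := hc _ _ Aa Bx; lra.
have lbB : lbound B (- c / 2 - a) by move=> x Bx; have := hc _ _ Aa Bx; lra.
have A0 : A !=set0 by exists a.
have B0 : B !=set0 by exists b.
(* Diameters replace measures: suprema add and infima add, and both sums stay in
   [[- c / 2, c / 2]]. *)
apply: (@le_trans _ _ ((sup A - inf A)%:E + (sup B - inf B)%:E)%E).
  apply: leeD; apply: lebesgue_measure_le_diam => //; split => //.
  - by exists (c / 2 - b).
  - by exists (- c / 2 - b).
  - by exists (c / 2 - a).
  - by exists (- c / 2 - a).
rewrite -EFinD lee_fin.
have h1 : sup A <= c / 2 - sup B.
  apply: ge_sup => // x Ax; rewrite lerBrDr -lerBrDl.
  by apply: ge_sup => // y By; have := hc _ _ Ax By; lra.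
have h2 : - c / 2 - inf B <= inf A.
  apply: lb_le_inf => // x Ax; rewrite lerBlDr -lerBlDl.
  by apply: lb_le_inf => // y By; have := hc _ _ Ax By; lra.
lra.
Qed.

(** With [w z = h (z / 2)] this is the usual midpoint inequality for an [h] of integral 1, whence
    the 2. Since [w] decreases with the absolute value, its superlevel sets are symmetric intervals,
    which is the case handled by [brunn_minkowski_interval]. *)
Lemma prekopa_leindler_symmetric u v w :
  measurable_fun setT u -> measurable_fun setT v -> measurable_fun setT w ->
  (forall x, 0 <= u x) -> (forall x, 0 <= v x) -> (forall x, 0 <= w x) ->
  (forall s t, `|s| <= `|t| -> w t <= w s) ->
  (forall x y, u x * v y <= w (x + y) ^+ 2) ->
  (\int[leb]_x (w x)%:E = 2%:E)%E ->
  (\int[leb]_x (u x)%:E * \int[leb]_x (v x)%:E <= 1)%E.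
Proof.
move=> mu_ mv mw u0 v0 w0 wd uvw iw.
have trivial_case f g : (forall x, ~ 0 < f x) -> (forall x, 0 <= f x) ->
    (\int[leb]_x (f x)%:E * \int[leb]_x (g x)%:E <= 1)%E.
  move=> f0 f0'; rewrite integral0_eq ?mul0e ?lee01//= => x _.
  by have := f0' x; rewrite le_eqVlt => /orP[/eqP <-//|/f0].
have [[x0 ux0]|nu] := pselect (exists x, 0 < u x); last first.
  by apply: trivial_case => // x ux; apply: nu; exists x.
have [[y0 vy0]|nv] := pselect (exists x, 0 < v x); last first.
  by rewrite muleC; apply: trivial_case => // x ux; apply: nv; exists x.
have w2 s : w s ^+ 2 <= w 0 ^+ 2.
  by rewrite ler_pXn2r// ?nnegrE// wd// normr0.
have su : has_sup (range u).
  split; first by exists (u x0), x0.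
  exists (w 0 ^+ 2 / v y0) => _ [x _ <-].
  by rewrite ler_pdivlMr//; exact: le_trans (w2 _).
have sv : has_sup (range v).
  split; first by exists (v y0), y0.
  exists (w 0 ^+ 2 / u x0) => _ [y _ <-].
  by rewrite ler_pdivlMr// mulrC; exact: le_trans (w2 _).
(* Dividing by the suprema makes the superlevel sets of both functions nonempty for the same levels
   [t < 1]; Brunn-Minkowski needs both to be nonempty. *)
set a := sup (range u); set b := sup (range v).
have ua x : u x <= a by apply: ub_le_sup; [case: su|exists x].
have vb x : v x <= b by apply: ub_le_sup; [case: sv|exists x].
have a0 : 0 < a by exact: lt_le_trans (ua x0).
have b0 : 0 < b by exact: lt_le_trans (vb y0).
set g := Num.sqrt (a * b).
have g2 : g ^+ 2 = a * b by rewrite sqr_sqrtr// ltW// mulr_gt0.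
have g0 : 0 < g by rewrite sqrtr_gt0 mulr_gt0.
pose u1 x := u x / a; pose v1 x := v x / b; pose w1 x := w x / g.
have mu1 : measurable_fun setT u1 by apply: measurable_funM.
have mv1 : measurable_fun setT v1 by apply: measurable_funM.
have mw1 : measurable_fun setT w1 by apply: measurable_funM.
have u10 x : 0 <= u1 x by rewrite divr_ge0// ltW.
have v10 x : 0 <= v1 x by rewrite divr_ge0// ltW.
have w10 x : 0 <= w1 x by rewrite divr_ge0// ltW.
have [mlu lu] := layer_cake mu1 u10.
have [mlv lv] := layer_cake mv1 v10.
have [mlw lw] := layer_cake mw1 w10.
have key : (\int[leb]_x (u1 x)%:E + \int[leb]_x (v1 x)%:E
    <= \int[leb]_x (w1 x)%:E)%E.
  rewrite lu lv lw -ge0_integralD//; [|exact: measurable_funTS..].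
  suff H t : 0 <= t -> (leb [set x | (t < u1 x)%R] + leb [set x | (t < v1 x)%R]
      <= leb [set x | (t < w1 x)%R])%E.
    apply: ge0_le_integral => //.
    - by move=> t _; rewrite adde_ge0.
    - by apply: emeasurable_funD; exact: measurable_funTS.
    - exact: measurable_funTS.
    - by move=> t /=; rewrite in_itv/= andbT; exact: H.
  move=> t0.
  have [t1|t1] := ltP t 1; last first.
    have -> : [set x | t < u1 x] = set0.
      rewrite -subset0 => x/=; rewrite ltNge => /negP; apply.
      by rewrite (le_trans _ t1)// /u1 ler_pdivrMr ?mul1r.
    have -> : [set x | t < v1 x] = set0.
      rewrite -subset0 => x/=; rewrite ltNge => /negP; apply.
      by rewrite (le_trans _ t1)// /v1 ler_pdivrMr ?mul1r.
    by rewrite measure0 add0e.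
  apply: brunn_minkowski_interval => [||x y /= xt yt].
  - have : t * a < a by rewrite gtr_pMl.
    by move=> /(sup_gt (su.1))[_ [x _ <-]] h; exists x; rewrite /= /u1 ltr_pdivlMr.
  - have : t * b < b by rewrite gtr_pMl.
    by move=> /(sup_gt (sv.1))[_ [x _ <-]] h; exists x; rewrite /= /v1 ltr_pdivlMr.
  have tw : t < w1 (x + y).
    rewrite /w1 ltr_pdivlMr//.
    suff : (t * g) ^+ 2 < w (x + y) ^+ 2.
      by rewrite ltr_pXn2r ?nnegrE ?mulr_ge0 ?(ltW g0).
    rewrite exprMn g2; apply: lt_le_trans (uvw x y); rewrite expr2.
    move: xt yt; rewrite /u1 /v1 !ltr_pdivlMr// => xt yt.
    rewrite mulrACA; apply: ltr_pM => //; by rewrite mulr_ge0// ltW.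
  apply: (@le_trans _ _ (leb `[- `|x + y|, `|x + y| ]%classic)).
    rewrite lebesgue_measure_itv/= lte_fin; case: ltP => h.
      by rewrite -EFinB opprK mulr2n.
    have : `|x + y| = 0 by apply/eqP; rewrite eq_le normr_ge0 andbT; lra.
    by move=> ->; rewrite mul0rn.
  apply: le_outer_measure => s /=; rewrite in_itv/= -ler_norml => hs.
  by apply: (lt_le_trans tw); rewrite /w1 ler_pM2r ?invr_gt0//; exact: wd.
have iu1 : (\int[leb]_x (u x)%:E = a%:E * \int[leb]_x (u1 x)%:E)%E.
  rewrite -ge0_integralZl//=; last 3 first.
  - exact/measurable_EFinP.
  - by move=> x _; rewrite lee_fin.
  - by rewrite lee_fin ltW.
  by apply: eq_integral => x _; rewrite /u1 -EFinM mulrCA divff ?mulr1// gt_eqF.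
have iv1 : (\int[leb]_x (v x)%:E = b%:E * \int[leb]_x (v1 x)%:E)%E.
  rewrite -ge0_integralZl//=; last 3 first.
  - exact/measurable_EFinP.
  - by move=> x _; rewrite lee_fin.
  - by rewrite lee_fin ltW.
  by apply: eq_integral => x _; rewrite /v1 -EFinM mulrCA divff ?mulr1// gt_eqF.
have iw1 : (\int[leb]_x (w1 x)%:E = (2 / g)%:E)%E.
  under eq_integral do rewrite /w1 mulrC EFinM.
  rewrite ge0_integralZl//=.
  - by rewrite iw -EFinM mulrC.
  - exact/measurable_EFinP.
  - by move=> x _; rewrite lee_fin.
  - by rewrite lee_fin invr_ge0 ltW.
rewrite iu1 iv1; rewrite iw1 in key.
have p0 : (0 <= \int[leb]_x (u1 x)%:E)%E by apply: integral_ge0 => x _; rewrite lee_fin.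
have q0 : (0 <= \int[leb]_x (v1 x)%:E)%E by apply: integral_ge0 => x _; rewrite lee_fin.
move: p0 q0 key; case: (integral _ _ _) => [p| |]//; case: (integral _ _ _) => [q| |]//.
rewrite -!EFinM !lee_fin => p0 q0; rewrite ler_pdivlMr// => key.
(* The additive inequality [p + q <= 2 / g] becomes multiplicative by the arithmetic-geometric mean
   inequality. *)
apply: (@le_trans _ _ (g ^+ 2 * ((p + q) ^+ 2 / 4))).
  by rewrite g2; have := sqr_ge0 (p - q); nra.
have h0 : 0 <= (p + q) * g by rewrite mulr_ge0 ?addr_ge0// ltW.
nra.
Qed.
End OneDim.

(** Uniqueness of the Radon-Nikodym derivative: [p] and the derivative have equal integrals over all
    measurable sets, so they agree almost everywhere. *)
Lemma ge0_integral_density d (T : measurableType d) (R : realType)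
    (nu : {finite_measure set T -> \bar R})
    (mu : {sigma_finite_measure set T -> \bar R}) (p : T -> R) (f : T -> \bar R) :
  measurable_fun setT p -> (forall x, 0 <= p x) ->
  (forall A, measurable A -> nu A = \int[mu]_(x in A) (p x)%:E)%E ->
  measurable_fun setT f -> (forall x, (0 <= f x)%E) ->
  (\int[nu]_x f x = \int[mu]_x (f x * (p x)%:E))%E.
Proof.
move=> mp p0 nuE mf f0.
have numu : nu `<< mu.
  apply/null_content_dominatesP => A mA A0; rewrite nuE//.
  by apply: null_set_integral => //; exact/measurable_funTS/measurable_EFinP.
rewrite -(Radon_Nikodym_SigmaFinite.change_of_variables numu)//.
have iRN := Radon_Nikodym_SigmaFinite.f_integrable numu.
have RN : ae_eq mu setT (Radon_Nikodym_SigmaFinite.f nu mu) (EFin \o p).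
  apply: integral_ae_eq => //; first exact/measurable_EFinP.
  by move=> E _ mE; rewrite -nuE// -Radon_Nikodym_SigmaFinite.f_integral.
apply: ge0_ae_eq_integral => //.
- apply: emeasurable_funM => //; exact: measurable_int iRN.
- by apply: emeasurable_funM => //; exact/measurable_EFinP.
- by move=> x _; rewrite mule_ge0// Radon_Nikodym_SigmaFinite.f_ge0.
- by move=> x _; rewrite mule_ge0// lee_fin.
- exact: ae_eqe_mul2l.
Qed.

(** * The one-dimensional Gaussian measure, including the degenerate case *)

Section Gauss1.
Context {R : realType}.
Local Notation leb := (@lebesgue_measure R).
Implicit Types (s sigma : R) (U V : R -> \bar R).

Let gauss10 s : gauss1 s set0 = 0%E.
Proof. by rewrite /gauss1; case: ifP => _; exact: measure0. Qed.

Let gauss1_ge0 s A : (0 <= gauss1 s A)%E.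
Proof. by rewrite /gauss1; case: ifP => _; exact: measure_ge0. Qed.

Let gauss1_sigma_additive s : semi_sigma_additive (gauss1 s).
Proof.
rewrite /gauss1; case: ifP => _; first exact: measure_semi_sigma_additive.
exact: (@measure_semi_sigma_additive _ _ _ (normal_prob 0 s)).
Qed.

HB.instance Definition _ s := isMeasure.Build _ _ _ (gauss1 s)
  (gauss10 s) (gauss1_ge0 s) (@gauss1_sigma_additive s).

Let gauss1_setT s : gauss1 s setT = 1%E.
Proof.
rewrite /gauss1; case: ifP => _; first exact: probability_setT.
exact: (probability_setT (normal_prob 0 s)).
Qed.

HB.instance Definition _ s := Measure_isProbability.Build _ _ _ (gauss1 s)
  (gauss1_setT s).

Lemma integral_gauss1_normal s U : s != 0 ->
  measurable_fun setT U -> (forall x, 0 <= U x)%E ->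
  (\int[gauss1 s]_x U x = \int[leb]_x (U x * (normal_pdf 0 s x)%:E))%E.
Proof.
move=> s0 mU U0.
(* The pushforward along the identity transports [normal_prob] from [measurableTypeR R] to [R]. *)
transitivity (\int[pushforward (normal_prob 0 s) (idfun : measurableTypeR R -> R)]_x U x)%E.
  by congr integral; apply/funext => A; rewrite /gauss1 (negbTE s0).
rewrite ge0_integral_pushforward//=; last by move=> _ A mA; rewrite setTI preimage_id.
apply: ge0_integral_density => //; first exact: measurable_normal_pdf.
by move=> x; exact: normal_pdf_ge0.
Qed.

Lemma integral_gauss1_0 U : measurable_fun setT U ->
  (\int[gauss1 0]_x U x = U 0%R)%E.
Proof. by move=> mU; rewrite /gauss1 eqxx integral_dirac// diracT mul1e. Qed.

(** This is the [w] given to Prekopa-Leindler below: its mass is 2, and the square of its value at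
    [x + y] is the product of the densities at [x] and [y] times [exp((x - y)^2 / (4 s^2))]. *)
Lemma normal_pdf0_double s x : s != 0 ->
  2 * normal_pdf 0 (2 * s) x = normal_peak s * expR (- x ^+ 2 / (8 * s ^+ 2)).
Proof.
move=> s0; rewrite normal_pdfE ?mulf_neq0// mulrA; congr (_ * _).
  rewrite /normal_peak exprMn -mulrA -mulrnAr.
  by rewrite (@sqrtrM _ (2 ^+ 2)) ?sqr_ge0// invfM sqrtr_sqr ger0_norm// mulrA divff ?mul1r.
rewrite /normal_fun subr0 exprMn -mulr_natr; congr (expR (_ / _)); ring.
Qed.

(* Maurey's property (tau). Allowing any [s >= |sigma|] in the cost covers the
   degenerate case [sigma = 0], where the cost would be the junk value 0. *)
Lemma gauss1_property_tau sigma s U V : 0 < s -> `|sigma| <= s ->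
  measurable_fun setT U -> measurable_fun setT V ->
  (forall x, 0 <= U x)%E -> (forall x, 0 <= V x)%E ->
  (forall x y, U x * V y <= (expR ((x - y) ^+ 2 / (4 * s ^+ 2)))%:E)%E ->
  (\int[gauss1 sigma]_x U x * \int[gauss1 sigma]_x V x <= 1)%E.
Proof.
move=> s0 ss mU mV U0 V0 UV.
have [->|sigma0] := eqVneq sigma 0.
  rewrite !integral_gauss1_0//; apply: le_trans (UV 0 0) _.
  by rewrite subrr expr0n/= mul0r expR0.
have trivial_case (f g : R -> \bar R) : (forall x, ~ (0 < f x)%E) -> (forall x, 0 <= f x)%E ->
    (\int[gauss1 sigma]_x f x * \int[gauss1 sigma]_x g x <= 1)%E.
  move=> f0 f0'; rewrite integral0_eq ?mul0e ?lee01//= => x _.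
  by have := f0' x; rewrite le_eqVlt => /orP[/eqP <-//|/f0].
have [[x0 ux0]|nu] := pselect (exists x, 0 < U x)%E; last first.
  by apply: trivial_case => // x ux; apply: nu; exists x.
have [[y0 vy0]|nv] := pselect (exists x, 0 < V x)%E; last first.
  by rewrite muleC; apply: trivial_case => // x ux; apply: nv; exists x.
(* A single point where the other factor is positive turns the cost bound into finiteness
   everywhere. *)
have Ufin x : U x = (fine (U x))%:E.
  rewrite fineK// ge0_fin_numE// ltey; apply/eqP => Uoo.
  by have := UV x y0; rewrite Uoo gt0_mulye.
have Vfin x : V x = (fine (V x))%:E.
  rewrite fineK// ge0_fin_numE// ltey; apply/eqP => Voo.
  by have := UV x0 x; rewrite Voo gt0_muley.
pose p x := normal_pdf 0 sigma x.
have mp : measurable_fun setT p by exact: measurable_normal_pdf.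
have p0 x : 0 <= p x by exact: normal_pdf_ge0.
have fU0 x : 0 <= fine (U x) by exact: fine_ge0.
have fV0 x : 0 <= fine (V x) by exact: fine_ge0.
pose w x := 2 * normal_pdf 0 (2 * sigma) x.
have mfU : measurable_fun setT (fun x => fine (U x)) by exact: measurableT_comp.
have mfV : measurable_fun setT (fun x => fine (V x)) by exact: measurableT_comp.
rewrite !integral_gauss1_normal//.
under eq_integral do rewrite Ufin -EFinM.
under [X in (_ * X)%E]eq_integral do rewrite Vfin -EFinM.
have peak0 := normal_peak_ge0 sigma.
have ss2 : sigma ^+ 2 <= s ^+ 2.
  by rewrite -[leLHS]real_normK ?num_real// ler_pXn2r ?nnegrE ?(ltW s0).
have sigma2 : 0 < sigma ^+ 2 by rewrite exprn_even_gt0.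
apply: (@prekopa_leindler_symmetric _ _ _ w).
- by apply: measurable_funM => //.
- by apply: measurable_funM => //.
- by apply: measurable_funM => //; exact: measurable_normal_pdf.
- by move=> x; rewrite mulr_ge0.
- by move=> x; rewrite mulr_ge0.
- by move=> x; rewrite mulr_ge0// normal_pdf_ge0.
- move=> a b ab; rewrite /w !normal_pdf0_double// ler_wpM2l// ler_expR.
  have k0 : 0 < (8 * sigma ^+ 2)^-1 by rewrite invr_gt0 mulr_gt0.
  rewrite (ler_pM2r k0) lerN2.
  by rewrite -(real_normK (num_real a)) -(real_normK (num_real b)) ler_pXn2r ?nnegrE.
- move=> x y; rewrite /w normal_pdf0_double// exprMn -expRM_natl.
  rewrite /p normal_pdfE// /normal_fun !subr0.
  have UVxy : fine (U x) * fine (V y) <= expR ((x - y) ^+ 2 / (4 * s ^+ 2)).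
    by rewrite -lee_fin EFinM -Ufin -Vfin.
  have regroup (a b c A B : R) :
    a * (c * A) * (b * (c * B)) = c ^+ 2 * (A * B * (a * b)) by ring.
  rewrite regroup -expRD ler_wpM2l ?sqr_ge0//.
  apply: (@le_trans _ _ (expR (- x ^+ 2 / (sigma ^+ 2 *+ 2) + - y ^+ 2 / (sigma ^+ 2 *+ 2))
      * expR ((x - y) ^+ 2 / (4 * s ^+ 2)))).
    by rewrite ler_wpM2l// expR_ge0.
  rewrite -expRD ler_expR.
  (* Replacing [s] by the smaller [|sigma|] enlarges the cost; what remains is the identity [- x^2/2
     - y^2/2 + (x - y)^2/4 = - (x + y)^2/4]. *)
  apply: (@le_trans _ _ (- x ^+ 2 / (sigma ^+ 2 *+ 2) + - y ^+ 2 / (sigma ^+ 2 *+ 2) +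
     (x - y) ^+ 2 / (4 * sigma ^+ 2))).
    rewrite lerD2l ler_wpM2l ?sqr_ge0// lef_pV2 ?posrE.
    - by rewrite ler_wpM2l.
    - by rewrite mulr_gt0// exprn_gt0.
    - by rewrite mulr_gt0.
  by rewrite le_eqVlt; apply/orP; left; apply/eqP; rewrite -mulr_natr; field.
- under eq_integral do rewrite EFinM.
  rewrite ge0_integralZl//=.
  + by rewrite integral_normal_pdf mule1.
  + by apply/measurable_EFinP; exact: measurable_normal_pdf.
  + by move=> x _; rewrite lee_fin normal_pdf_ge0.
Qed.

(** Completing the square moves the centre of the density to [a * sigma ^+ 2]. *)
Lemma gauss1_laplace sigma (a : R) :
  (\int[gauss1 sigma]_x (expR (a * x))%:E = (expR (a ^+ 2 * sigma ^+ 2 / 2))%:E)%E.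
Proof.
have mexp : measurable_fun setT (fun x : R => (expR (a * x))%:E).
  apply/measurable_EFinP; exact: measurableT_comp.
have [->|s0] := eqVneq sigma 0.
  by rewrite integral_gauss1_0// expr0n/= !mulr0 mul0r.
rewrite integral_gauss1_normal//.
transitivity (\int[leb]_x ((expR (a ^+ 2 * sigma ^+ 2 / 2))%:E *
    (normal_pdf (a * sigma ^+ 2) sigma x)%:E))%E.
  apply: eq_integral => x _; rewrite -!EFinM !normal_pdfE// /normal_fun; congr EFin.
  rewrite mulrCA [RHS]mulrCA; congr (_ * _); rewrite -!expRD; congr expR.
  by rewrite -mulr_natr; field.
rewrite ge0_integralZl//=.
- by rewrite integral_normal_pdf mule1.
- by apply/measurable_EFinP; exact: measurable_normal_pdf.
- by move=> x _; rewrite lee_fin normal_pdf_ge0.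
Qed.

End Gauss1.

(** * The Gaussian measure in dimension n *)

Section GaussN.
Context {R : realType}.
Implicit Types (s sigma : R) (n : nat).

Lemma eucl_sqr n (x y : n.-tuple R) :
  eucl x y ^+ 2 = \sum_(i < n) (tnth x i - tnth y i) ^+ 2.
Proof. by rewrite sqr_sqrtr// sumr_ge0// => i _; rewrite sqr_ge0. Qed.

Lemma eucl_ge0 n (x y : n.-tuple R) : 0 <= eucl x y.
Proof. exact: sqrtr_ge0. Qed.

Lemma eucl_cons_sqr n (a b : R) (x y : n.-tuple R) :
  eucl (cons_tuple a x) (cons_tuple b y) ^+ 2 = (a - b) ^+ 2 + eucl x y ^+ 2.
Proof.
rewrite !eucl_sqr big_ord_recl /= !tnth0; congr (_ + _).
by apply: eq_bigr => i _; rewrite !tnthS.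
Qed.

Definition cons_pair n (p : R * n.-tuple R) : n.+1.-tuple R :=
  cons_tuple p.1 p.2.

Lemma measurable_cons_pair n : measurable_fun setT (@cons_pair n).
Proof. exact: measurable_cons. Qed.

HB.instance Definition _ n :=
  isMeasurableFun.Build _ _ _ _ (@cons_pair n) (@measurable_cons_pair n).

(** Source of everything structural about [gauss]: additivity, total mass and the iterated integral
    all come from the product measure. *)
Lemma gaussS_pushforward n s : @gauss R n.+1 s =
  pushforward (product_measure1 (gauss1 s) (@gauss R n s)) (@cons_pair n).
Proof.
apply/funext => A /=; apply: eq_integral => x _ /=; congr gauss.
by apply/seteqP; split => t; rewrite /xsection/= inE.
Qed.

Let gauss_ge0 n s (A : set (n.-tuple R)) : (0 <= gauss s A)%E.
Proof.
elim: n A => [|n IH] A /=; first by rewrite lee_fin.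
by apply: integral_ge0.
Qed.

Let gauss0 n s : @gauss R n s set0 = 0%E.
Proof.
elim: n => [|n IH]; first by rewrite /= indicE in_set0.
by rewrite /= integral0_eq.
Qed.

(** Both claims go through one induction, since the product measure of the next dimension can be
    formed only once [gauss] in dimension [n] is packed as a probability. *)
Let gauss_probability n s :
  semi_sigma_additive (@gauss R n s) /\ @gauss R n s setT = 1%E.
Proof.
elim: n => [|n [sa g1]].
  split; last by rewrite /= indicE in_setT.
  exact: (@measure_semi_sigma_additive _ _ _ (\d_([tuple] : 0.-tuple R))).
pose m := isMeasure.Build _ _ _ (@gauss R n s) (gauss0 n s) (@gauss_ge0 n s) sa.
pose M : {measure set _ -> \bar R} := HB.pack (@gauss R n s) m.
pose p := Measure_isProbability.Build _ _ _ M g1.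
pose P : probability _ R := HB.pack (@gauss R n s) m p.
rewrite gaussS_pushforward; split.
  exact: (@measure_semi_sigma_additive _ _ _
    (distribution (product_measure1 (gauss1 s) P) (@cons_pair n))).
exact: (probability_setT
    (distribution (product_measure1 (gauss1 s) P) (@cons_pair n))).
Qed.

HB.instance Definition _ n s := isMeasure.Build _ _ _ (@gauss R n s)
  (gauss0 n s) (@gauss_ge0 n s) (gauss_probability n s).1.

HB.instance Definition _ n s := Measure_isProbability.Build _ _ _
  (@gauss R n s) (gauss_probability n s).2.

Lemma integral_gauss0 s (W : 0.-tuple R -> \bar R) : measurable_fun setT W ->
  (\int[gauss s]_x W x = W [tuple])%E.
Proof.
move=> mW; transitivity (\int[\d_([tuple] : 0.-tuple R)]_x W x)%E.
  exact: eq_measure_integral.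
by rewrite integral_dirac// diracT mul1e.
Qed.

Lemma measurable_gauss_section n s (U : n.+1.-tuple R -> \bar R) :
  measurable_fun setT U -> (forall x, 0 <= U x)%E ->
  measurable_fun setT (fun x => (\int[gauss s]_t U (cons_tuple x t))%E).
Proof.
move=> mU U0.
apply: (@measurable_fun_fubini_tonelli_F _ _ _ _ _ (gauss s) (U \o @cons_pair n)) => //=.
by apply: measurableT_comp => //; exact: measurable_cons_pair.
Qed.

Lemma integral_gaussS n s (U : n.+1.-tuple R -> \bar R) :
  measurable_fun setT U -> (forall x, 0 <= U x)%E ->
  (\int[gauss s]_x U x =
   \int[gauss1 s]_x (\int[gauss s]_t U (cons_tuple x t)))%E.
Proof.
move=> mU U0.
transitivity (\int[distribution (product_measure1 (gauss1 s) (@gauss R n s))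
    (@cons_pair n)]_x U x)%E.
  by rewrite gaussS_pushforward.
rewrite ge0_integral_distribution// fubini_tonelli1//.
- by apply: measurableT_comp => //; exact: measurable_cons_pair.
- by move=> x /=; exact: U0.
Qed.

Lemma measurable_cons_tuple n (x : R) :
  measurable_fun setT (fun t : n.-tuple R => cons_tuple x t).
Proof. exact: measurable_cons. Qed.

(** Tensorization: the squared distance is the first-coordinate part plus the rest. For fixed first
    coordinates the induction hypothesis bounds the product of the inner integrals by the
    one-dimensional cost, so those integrals satisfy [gauss1_property_tau]. *)
Lemma gauss_property_tau n sigma s (U V : n.-tuple R -> \bar R) :
  0 < s -> `|sigma| <= s ->
  measurable_fun setT U -> measurable_fun setT V ->
  (forall x, 0 <= U x)%E -> (forall x, 0 <= V x)%E ->
  (forall x y, U x * V y <= (expR (eucl x y ^+ 2 / (4 * s ^+ 2)))%:E)%E ->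
  (\int[gauss sigma]_x U x * \int[gauss sigma]_x V x <= 1)%E.
Proof.
move=> s0 ss; elim: n U V => [|n IH] U V mU mV U0 V0 UV.
  rewrite !integral_gauss0//; apply: le_trans (UV _ _) _.
  by rewrite eucl_sqr big_ord0 mul0r expR0.
rewrite !integral_gaussS//.
apply: (gauss1_property_tau s0 ss).
- exact: measurable_gauss_section.
- exact: measurable_gauss_section.
- by move=> x; exact: integral_ge0.
- by move=> x; exact: integral_ge0.
(* The first-coordinate cost [k] is divided out of [V], so that the sections meet the hypothesis in
   dimension [n]. *)
move=> x y; set k := expR _.
have k0 : 0 < k by exact: expR_gt0.
rewrite -[k%:E]mul1e -lee_pdivrMr// -muleA.
have mVy : measurable_fun setT (fun t : n.-tuple R => V (cons_tuple y t)).
  by apply: measurableT_comp => //; exact: measurable_cons_tuple.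
have -> : (\int[gauss sigma]_t V (cons_tuple y t) * (k^-1)%:E =
    \int[gauss sigma]_t (V (cons_tuple y t) * (k^-1)%:E))%E.
  by rewrite ge0_integralZr// lee_fin invr_ge0 ltW.
apply: IH => //=.
- by apply: measurableT_comp => //; exact: measurable_cons_tuple.
- by apply: emeasurable_funM.
- by move=> t; rewrite mule_ge0// lee_fin invr_ge0 ltW.
move=> t u; rewrite muleA lee_pdivrMr//.
apply: le_trans (UV _ _) _; rewrite -EFinM lee_fin -expRD ler_expR.
by rewrite eucl_cons_sqr mulrDl addrC.
Qed.

Lemma measurable_lin n (a : 'I_n -> R) :
  measurable_fun setT (fun z : n.-tuple R => \sum_(i < n) a i * tnth z i).
Proof.
apply: measurable_sum => i; apply: measurable_funM => //.
exact: measurable_tnth.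
Qed.

Lemma gauss_laplace n sigma (a : 'I_n -> R) :
  (\int[gauss sigma]_z (expR (\sum_(i < n) a i * tnth z i))%:E =
   (expR ((\sum_(i < n) a i ^+ 2) * sigma ^+ 2 / 2))%:E)%E.
Proof.
elim: n a => [|n IH] a.
  rewrite integral_gauss0 ?big_ord0 ?mul0r ?expR0//.
  by apply/measurable_EFinP; apply: measurableT_comp => //; exact: measurable_lin.
have mE k (b : 'I_k -> R) : measurable_fun setT
    (fun z : k.-tuple R => (expR (\sum_(i < k) b i * tnth z i))%:E).
  apply/measurable_EFinP; apply: measurableT_comp => //.
  exact: measurable_lin.
rewrite integral_gaussS//=.
transitivity (\int[gauss1 sigma]_x ((expR (a ord0 * x))%:E *
   (expR ((\sum_(i < n) a (lift ord0 i) ^+ 2) * sigma ^+ 2 / 2))%:E))%E.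
  apply: eq_integral => x _; rewrite -IH -ge0_integralZl//=.
    apply: eq_integral => t _; rewrite -EFinM -expRD big_ord_recl tnth0.
    by congr (expR (_ + _))%:E; apply: eq_bigr => i _; rewrite tnthS.
  exact: mE.
rewrite ge0_integralZr//=.
- rewrite gauss1_laplace -EFinM -expRD big_ord_recl; congr (expR _)%:E.
  by rewrite !mulrDl.
- apply/measurable_EFinP; exact: measurableT_comp.
Qed.

(** Turns Laplace transforms into second moments. For [x >= 0], [x <= (1 + x/4)^2 <= exp(x/2)], and
    squaring gives the claim. *)
Lemma sqr_le_expR (x : R) : x ^+ 2 <= expR x + expR (- x).
Proof.
wlog x0 : x / 0 <= x.
  move=> h; have [/h//|/ltW x0] := leP 0 x.
  by have := h (- x); rewrite sqrrN opprK addrC; apply; rewrite oppr_ge0.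
apply: (@le_trans _ _ (expR x)); last by rewrite lerDl expR_ge0.
have e1 : (1 + x / 4) ^+ 2 <= expR (x / 4) ^+ 2.
  by rewrite ler_pXn2r ?nnegrE ?expR_ge0// ?expR_ge1Dx// addr_ge0// divr_ge0.
have e2 : x <= expR (x / 4) ^+ 2.
  by apply: le_trans e1; have := sqr_ge0 (1 - x / 4); nra.
have -> : expR x = (expR (x / 4) ^+ 2) ^+ 2.
  by rewrite -!expRM_natl; congr expR; lra.
by rewrite ler_pXn2r// nnegrE// ltW// exprn_gt0 ?expR_gt0.
Qed.

(** Scaling [a] by [1 / s] makes the Laplace exponent [sigma^2 / (2 s^2) <= 1/2]; the two
    exponentials of [sqr_le_expR] then give the constant [2 * expR 2^-1]. It is cruder than
    [sigma ^+ 2], but independent of [n]. *)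
Lemma gauss_second_moment n sigma s (a : 'I_n -> R) : 0 < s -> `|sigma| <= s ->
  \sum_(i < n) a i ^+ 2 = 1 ->
  (\int[gauss sigma]_z ((\sum_(i < n) a i * tnth z i) ^+ 2)%:E <=
   (s ^+ 2 * (2 * expR 2^-1))%:E)%E.
Proof.
move=> s0 ss a1.
have mE (b : 'I_n -> R) : measurable_fun setT
    (fun z : n.-tuple R => (expR (\sum_(i < n) b i * tnth z i))%:E).
  apply/measurable_EFinP; apply: measurableT_comp => //.
  exact: measurable_lin.
pose E (b : 'I_n -> R) (z : n.-tuple R) := (expR (\sum_(i < n) b i * tnth z i))%:E.
have E0 b z : (0 <= E b z)%E by rewrite lee_fin expR_ge0.
pose b i := a i / s; pose c i := - b i.
have ss2 : sigma ^+ 2 <= s ^+ 2.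
  by rewrite -[leLHS]real_normK ?num_real// ler_pXn2r ?nnegrE ?(ltW s0).
have LE (e : 'I_n -> R) : (forall i, e i ^+ 2 = (a i / s) ^+ 2) ->
    (\int[gauss sigma]_z E e z <= (expR 2^-1)%:E)%E.
  move=> ea; rewrite gauss_laplace lee_fin ler_expR.
  under eq_bigr do rewrite ea exprMn.
  rewrite -mulr_suml a1 mul1r exprVn -[leRHS]mul1r ler_pM2r//.
  by rewrite mulrC ler_pdivrMr ?mul1r// exprn_gt0.
apply: (@le_trans _ _ (\int[gauss sigma]_z ((s ^+ 2)%:E * (E b z + E c z)))%E).
  apply: ge0_le_integral => //.
  - by move=> z _; rewrite lee_fin sqr_ge0.
  - by apply/measurable_EFinP; apply: measurable_funX; exact: measurable_lin.
  - apply: emeasurable_funM => //; apply: emeasurable_funD; exact: mE.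
  move=> z _; rewrite -EFinD -EFinM lee_fin.
  have -> : \sum_(i < n) a i * tnth z i = s * \sum_(i < n) b i * tnth z i.
    rewrite mulr_sumr; apply: eq_bigr => i _.
    by rewrite /b mulrA mulrCA divff ?mulr1// gt_eqF.
  have -> : \sum_(i < n) c i * tnth z i = - \sum_(i < n) b i * tnth z i.
    by rewrite -sumrN; apply: eq_bigr => i _; rewrite /c mulNr.
  by rewrite exprMn ler_wpM2l ?sqr_ge0// sqr_le_expR.
rewrite ge0_integralZl//=; last 3 first.
- by apply: emeasurable_funD; exact: mE.
- by move=> z _; rewrite adde_ge0.
- by rewrite lee_fin sqr_ge0.
rewrite ge0_integralD//=; [|exact: mE|exact: mE].
rewrite [leRHS]EFinM lee_wpmul2l ?lee_fin ?sqr_ge0//.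
rewrite mulr_natl mulr2n EFinD; apply: leeD; apply: LE => // i.
by rewrite /c sqrrN.
Qed.

End GaussN.

(** * Parametrization of Borel probability measures by the unit interval *)

Section TernaryCode.
Context {R : realType}.
Implicit Types b : nat -> bool.

(* Only the ternary digits 0 and 2 are used: the resulting gap ]1/3, 2/3[ makes
   the first digit the outcome of the comparison with 1/2. *)
Fixpoint ternary_approx n b : R :=
  if n is m.+1 then ((b 0%N)%:R *+ 2 + ternary_approx m (b \o S)) / 3 else 0.

Definition ternary b : R := sup (range (ternary_approx ^~ b)).

Lemma ternary_approx_bounds n b : 0 <= ternary_approx n b <= 1.
Proof.
elim: n b => [|n IH] b /=; first by rewrite lexx ler01.
have /andP[h0 h1] := IH (b \o S).
have : 0 <= ((b 0%N)%:R : R) <= 1 by case: (b 0%N); rewrite /= ?lexx ler01.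
by move=> /andP[b0 b1]; rewrite -mulr_natr; apply/andP; split; lra.
Qed.

Lemma ternary_has_sup b : has_sup (range (ternary_approx ^~ b)).
Proof.
split; first by exists (ternary_approx 0 b), 0%N.
by exists 1 => _ [n _ <-]; case/andP: (ternary_approx_bounds n b).
Qed.

Lemma ternary_approx_le n b : ternary_approx n b <= ternary b.
Proof. by apply: ub_le_sup; [case: (ternary_has_sup b)|exists n]. Qed.

Lemma ternary_bounds b : 0 <= ternary b <= 1.
Proof.
apply/andP; split; first exact: (ternary_approx_le 0).
apply: ge_sup; first by case: (ternary_has_sup b).
by move=> _ [n _ <-]; case/andP: (ternary_approx_bounds n b).
Qed.

Lemma ternaryE b : ternary b = ((b 0%N)%:R *+ 2 + ternary (b \o S)) / 3.
Proof.
have b0 : 0 <= ((b 0%N)%:R : R) by case: (b 0%N).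
apply/eqP; rewrite eq_le; apply/andP; split.
  apply: ge_sup; first by case: (ternary_has_sup b).
  move=> _ [[|n] _ <-] /=.
    by have /andP[h _] := ternary_bounds (b \o S); rewrite -mulr_natr; lra.
  by rewrite ler_pM2r// lerD2l ternary_approx_le.
rewrite ler_pdivrMr// -lerBrDl; apply: ge_sup; first by case: (ternary_has_sup (b \o S)).
move=> _ [n _ <-]; have := ternary_approx_le n.+1 b; rewrite /= ler_pdivrMr//; lra.
Qed.

(** On a code, each step deletes the leading digit, so digit [n] is read as the first digit of
    remainder [n]. Elsewhere the values are arbitrary but still Borel. *)
Fixpoint ternary_rem n (t : R) : R :=
  if n is m.+1 then 3 * ternary_rem m t - (if 2^-1 <= ternary_rem m t then 2 else 0)
  else t.

Definition ternary_digit n (t : R) : bool := 2^-1 <= ternary_rem n t.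

Lemma ternary_first_digit b : (2^-1 <= ternary b) = b 0%N.
Proof.
rewrite ternaryE; have /andP[] := ternary_bounds (b \o S).
case: (b 0%N) => /= h0 h1; apply/idP/idP => //; try lra.
Qed.

Lemma ternary_remE n b : ternary_rem n (ternary b) = ternary (fun k => b (n + k)%N).
Proof.
elim: n => [|n IH] //=; rewrite IH ternary_first_digit [X in 3 * X]ternaryE addn0.
have -> : (fun k => b (n + k)%N) \o S = (fun k => b (n.+1 + k)%N).
  by apply/funext => k /=; rewrite addnS.
by case: (b n) => /=; lra.
Qed.

Lemma ternary_digitE n b : ternary_digit n (ternary b) = b n.
Proof. by rewrite /ternary_digit ternary_remE ternary_first_digit addn0. Qed.

Lemma measurable_ternary_rem n : measurable_fun setT (ternary_rem n).
Proof.
elim: n => [|n IH]; first exact: measurable_id.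
apply: measurable_funB; first exact: measurable_funM.
by apply: measurable_fun_ifT => //; exact: measurable_fun_ler.
Qed.

Lemma measurable_ternary_digit n : measurable_fun setT (ternary_digit n).
Proof. by apply: measurable_fun_ler => //; exact: measurable_ternary_rem. Qed.

Lemma measurable_ternary d (X : measurableType d) (b : X -> nat -> bool) :
  (forall n, measurable_fun setT (b ^~ n)) ->
  measurable_fun setT (fun x => ternary (b x)).
Proof.
move=> mb.
have mE n : measurable_fun setT (fun x => ternary_approx n (b x)).
  elim: n b mb => [|n IH] b mb; first exact: measurable_cst.
  apply: measurable_funM => //; apply: measurable_funD.
    apply: (eq_measurable_fun (fun x => if b x 0%N then 2 : R else 0)).
      by move=> x _; case: (b x 0%N); rewrite /= ?mul0rn.
    exact: measurable_fun_ifT.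
  by apply: (IH (fun x => b x \o S)) => k; exact: mb.
apply: (eq_measurable_fun (fun x => sups (fun n => ternary_approx n (b x)) 0)).
  move=> x _; rewrite /sups /ternary /sdrop /=; congr sup.
  by apply/seteqP; split => y [n] //= _ <-; exists n.
apply: (@measurable_fun_sups _ _ _ setT (fun n x => ternary_approx n (b x))) => // x _.
by case: (ternary_has_sup (b x)).
Qed.
End TernaryCode.

(** * Borel coding of Euclidean space by real numbers *)

Section StandardBorel.
Context {R : realType}.

(** A Borel retraction instead of an isomorphism: enough to carry a parametrization of the law of
    [i] back through [k], and easily stable under products. *)
Definition borel_codable d (X : measurableType d) :=
  exists (i : X -> R) (k : R -> X),
    [/\ measurable_fun setT i, measurable_fun setT k & cancel i k].

Lemma borel_codable_real : @borel_codable _ R.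
Proof. by exists idfun, idfun; split => //; exact: measurable_id. Qed.

(* A pair is recovered from the Dedekind cuts of its two coordinates, that is,
   from countably many bits indexed by [bool * rat]. *)
Definition cut_bits (p : R * R) (n : nat) : bool :=
  match @unpickle (bool * rat)%type n with
  | Some (j, q) => ratr q < (if j then p.1 else p.2)
  | None => false
  end.

(** The value [-oo] is neutral for suprema: cleared bits, bits of the other coordinate and invalid
    indices drop out, and the supremum over [n] is that of the rationals below coordinate [j]. *)
Definition cut_value (j : bool) (n : nat) (t : R) : \bar R :=
  match @unpickle (bool * rat)%type n with
  | Some (j', q) =>
      if (j' == j) && ternary_digit n t then (ratr q)%:E else -oo%E
  | None => -oo%E
  end.

Lemma measurable_cut_bits n : measurable_fun setT (cut_bits ^~ n).
Proof.
rewrite /cut_bits; case: unpickle => [[[] q]|]; last exact: measurable_cst.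
- by apply: measurable_fun_ltr => //; exact: measurable_fst.
- by apply: measurable_fun_ltr => //; exact: measurable_snd.
Qed.

Lemma measurable_cut_value j n : measurable_fun setT (cut_value j n).
Proof.
rewrite /cut_value; case: unpickle => [[j' q]|]; last exact: measurable_cst.
case: (j' == j) => /=; last exact: measurable_cst.
apply: measurable_fun_ifT => //; exact: measurable_ternary_digit.
Qed.

Lemma esups_cut_value j p :
  esups (fun n => cut_value j n (ternary (cut_bits p))) 0%N =
  (if j then p.1 else p.2)%:E.
Proof.
set c := if j then _ else _.
apply/eqP; rewrite eq_le; apply/andP; split.
  apply: ge_ereal_sup => _ [n _ <-]; rewrite /cut_value ternary_digitE /cut_bits.
  case: unpickle => [[j' q]|]; last by rewrite leNye.
  case: eqP => [->|_] /=; last by rewrite leNye.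
  by case: ifP => [/ltW|_]; rewrite ?lee_fin// leNye.
apply/lee_addgt0Pr => e e0.
have : c - e < c by rewrite ltrBlDr ltrDl.
move=> /rat_in_itvoo[q]; rewrite in_itv/= => /andP[q1 q2].
apply: (@le_trans _ _ ((ratr q)%:E + e%:E)%E).
  by rewrite -EFinD lee_fin -lerBlDr ltW.
rewrite leeD2r//; apply: ereal_sup_ubound; exists (pickle (j, q)) => //=.
by rewrite /cut_value ternary_digitE /cut_bits pickleK eqxx /= q2.
Qed.

Lemma borel_codable_real2 : @borel_codable _ (R * R)%type.
Proof.
pose v j (t : R) : R := fine (esups (fun n => cut_value j n t) 0%N).
have mv j : measurable_fun setT (v j).
  apply: measurableT_comp => //.
  by apply: (@measurable_fun_esups _ _ _ setT (cut_value j)) => n; exact: measurable_cut_value.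
exists (fun p => ternary (cut_bits p)), (fun t => (v true t, v false t)); split.
- by apply: measurable_ternary => n; exact: measurable_cut_bits.
- by apply/measurable_fun_pairP; split; exact: mv.
- by move=> p; rewrite /v !esups_cut_value /=; case: p.
Qed.

Lemma borel_codable_prod d1 d2 (X : measurableType d1) (Y : measurableType d2) :
  borel_codable X -> borel_codable Y -> borel_codable (X * Y)%type.
Proof.
move=> [i [k [mi mk ik]]] [i' [k' [mi' mk' ik']]].
have [c [e [mc me ce]]] := borel_codable_real2.
exists (fun p => c (i p.1, i' p.2)), (fun t => (k (e t).1, k' (e t).2)); split.
- apply: measurableT_comp => //; apply/measurable_fun_pairP; split => /=.
    by apply: (measurableT_comp mi); exact: measurable_fst.
  by apply: (measurableT_comp mi'); exact: measurable_snd.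
- apply/measurable_fun_pairP; split => /=.
    by apply: (measurableT_comp mk); apply: (measurableT_comp measurable_fst).
  by apply: (measurableT_comp mk'); apply: (measurableT_comp measurable_snd).
- by move=> [x y] /=; rewrite ce/= ik ik'.
Qed.

Lemma borel_codable_tuple n : @borel_codable _ (n.-tuple R).
Proof.
elim: n => [|n IH].
  exists (cst 0), (cst [tuple]); split => //.
  by move=> x; rewrite /= (tuple0 x).
have [i [k [mi mk ik]]] := borel_codable_prod borel_codable_real IH.
exists (fun x : n.+1.-tuple R => i (thead x, [tuple of behead x])), (fun t => cons_pair (k t)); split.
- apply: measurableT_comp => //; apply/measurable_fun_pairP; split => /=.
    exact: measurable_tnth.
  exact: measurable_behead.
- by apply: measurableT_comp => //; exact: measurable_cons_pair.
- by move=> x; rewrite ik /cons_pair/= [RHS]tuple_eta; apply/val_inj.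
Qed.
End StandardBorel.

(** * The quantile transform *)

Section Quantile.
Context {R : realType} d (X : measurableType d) (P : probability X R)
  (i : {RV P >-> R}).
Local Notation leb := (@lebesgue_measure R).

(** Generalized inverse of the distribution function. Within the unit interval the default 0 is
    taken only at the two endpoints, a null set. *)
Definition quantile (t : R) : R :=
  if 0 < t < 1 then sup [set x | (cdf i x < t%:E)%E] else 0.

Let quantile_has_sup t : 0 < t < 1 -> has_sup [set x | (cdf i x < t%:E)%E].
Proof.
move=> /andP[t0 t1]; split.
  have := @cvg_cdfNy0 _ _ _ P i => /(_ [set y | (y < t%:E)%E]).
  case; first by apply: open_nbhs_nbhs; split; [exact: open_ereal_lt_ereal|rewrite /= lte_fin].
  move=> M [Mr h]; exists (M - 1); apply: h => /=.
  by rewrite ltrBlDr ltrDl.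
have := @cvg_cdfy1 _ _ _ P i => /(_ [set y | (t%:E < y)%E]).
case; first by apply: open_nbhs_nbhs; split; [exact: open_ereal_gt_ereal|rewrite /= lte_fin].
move=> M [Mr h]; exists (M + 1) => x /= xt; rewrite leNgt; apply/negP => Mx.
have /= : (t%:E < cdf i x)%E by apply: h; rewrite (lt_trans _ Mx)// ltrDl.
by rewrite ltNge (ltW xt).
Qed.

(** Right continuity of [cdf] gives the strict inequality from right to left: [cdf i x < t] persists
    at some [y > x], and [y] is below the supremum. *)
Lemma lt_quantile t x : 0 < t < 1 -> (x < quantile t) = (cdf i x < t%:E)%E.
Proof.
move=> t01; rewrite /quantile t01; have ht := quantile_has_sup t01.
apply/idP/idP => [|xt].
  move=> /(sup_gt ht.1)[y /= yt xy]; apply: le_lt_trans yt.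
  exact/cdf_nondecreasing/ltW.
have := @cdf_right_continuous _ _ _ P i x => /(_ [set y | (y < t%:E)%E]) rc.
have {}rc : \forall r \near x^'+, (cdf i r < t%:E)%E.
  by apply: rc; apply: open_nbhs_nbhs; split; [exact: open_ereal_lt_ereal|].
have [y [xy yt]] : exists y, x < y /\ (cdf i y < t%:E)%E.
  apply: (@filter_ex _ (x^'+)); near=> r; split; near: r => //.
  exact: nbhs_right_gt.
by apply: (lt_le_trans xy); apply: ub_le_sup; [case: ht|].
Unshelve. all: by end_near. Qed.

Lemma measurable_quantile : measurable_fun (setT : set R) quantile.
Proof.
move=> mT; apply: (measurability _ (RGenOInfty.measurableE R)) => //.
move=> _ [_ [x ->] <-]; rewrite setTI.
rewrite (_ : _ @^-1` _ = (`]0%R, 1%R[ `&` [set t | (cdf i x < t%:E)%E]) `|`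
   (~` `]0%R, 1%R[ `&` [set t : R | x < 0])).
  apply: measurableU; apply: measurableI.
  - exact: measurable_itv.
  - have -> : [set t | (cdf i x < t%:E)%E] = `]fine (cdf i x), +oo[%classic.
      apply/seteqP; split => t /=;
        by rewrite in_itv/= andbT -lte_fin fineK//; exact: fin_num_measure.
    exact: measurable_itv.
  - by apply: measurableC; exact: measurable_itv.
  - have [x0|x0] := pselect (x < 0).
      by have -> : [set _ | x < 0] = [set: R] by apply/seteqP; split.
    by have -> : [set _ | x < 0] = @set0 R by apply/seteqP; split.
apply/seteqP; split => t /=; rewrite !in_itv/= andbT.
  have [t01|t01] := boolP (0 < t < 1); first by rewrite lt_quantile//; left.
  by rewrite /quantile (negbTE t01); right.
case=> -[t01 h]; first by rewrite lt_quantile.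
by rewrite /quantile; move/negP/negbTE : t01 => ->.
Qed.

Lemma quantile_gt_measure x :
  leb (`[0%R, 1%R] `&` quantile @^-1` `]x, +oo[) = (1 - cdf i x)%E.
Proof.
have cfin : cdf i x \is a fin_num by exact: fin_num_measure.
have mq : measurable (quantile @^-1` `]x, +oo[).
  by rewrite -[X in measurable X]setTI; apply: measurable_quantile => //; exact: measurable_itv.
transitivity (leb `]fine (cdf i x), 1%R[%classic).
  have c0 : 0 <= fine (cdf i x) by rewrite fine_ge0// cdf_ge0.
  (* The endpoints are removed because [quantile] takes its default value there. *)
  have E : (`[0%R, 1%R] `&` quantile @^-1` `]x, +oo[) `\` [set 0; 1] =
      `]fine (cdf i x), 1%R[ `\` [set 0; 1].
    apply/seteqP; split => t /=; rewrite !in_itv/= ?andbT.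
      move=> [[/andP[t0 t1] xt] /not_orP[/eqP tn0 /eqP tn1]].
      have t01 : 0 < t < 1 by rewrite !lt_neqAle eq_sym tn0 tn1 t0 t1.
      move: xt; rewrite lt_quantile// -[cdf i x]fineK// lte_fin => ->.
      by case/andP: t01 => _ ->; split => // -[/eqP|/eqP]; apply/negP.
    move=> [/andP[ct t1] tn]; have t0 : 0 < t by exact: le_lt_trans ct.
    rewrite lt_quantile ?t0// -[cdf i x]fineK// lte_fin ct !ltW//.
  have m01 : measurable ([set 0; 1] : set R) by exact: measurableU.
  have z : leb [set 0%R; 1%R] = 0%E.
    by apply: countable_lebesgue_measure0; exact/finite_set_countable/finite_set2.
  have D (A : set R) : measurable A -> leb (A `\` [set 0; 1]) = leb A.
    move=> mA; apply/eqP; rewrite eq_le; apply/andP; split.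
      by apply: le_outer_measure => ? [].
    rewrite -[leRHS](measureU0 _ _ z)//; last exact: measurableD.
    apply: le_outer_measure => t At.
    by have [?|?] := pselect ([set 0; 1] t); [right|left].
  rewrite -D; last by apply: measurableI => //; exact: measurable_itv.
  by rewrite E D//; exact: measurable_itv.
rewrite lebesgue_measure_itv/= lte_fin.
have := cdf_le1 i x; rewrite -[cdf i x]fineK// lee_fin => c1.
rewrite -[X in (_ - X)%E]fineK// -EFinB; case: ltP => // h.
by rewrite (_ : fine (cdf i x) = 1) ?subrr//; apply/eqP; rewrite eq_le c1.
Qed.

(** Two measures that agree on the rays []x, +oo[], a generating class closed under intersection,
    are equal. *)
Lemma quantile_distribution (A : set R) : measurable A ->
  P (i @^-1` A) = leb (`[0%R, 1%R] `&` quantile @^-1` A).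
Proof.
move=> mA.
have m01 : measurable (`[0%R, 1%R]%classic : set R) by exact: measurable_itv.
pose q : measurableTypeR R -> R := quantile.
have mq : measurable_fun setT q by exact: measurable_quantile.
pose m2 : {measure set R -> \bar R} :=
  pushforward (mrestr leb m01) q.
transitivity (m2 mq A); last by rewrite /m2/= /pushforward /mrestr setIC.
apply: (measure_unique (@RGenOInfty.G R) (fun n => `](- n%:R), +oo[%classic)
   _ _ _ _ (distribution P i) (m2 mq)) => //.
- exact: RGenOInfty.measurableE.
- move=> _ _ [x ->] [y ->]; exists (Num.max x y).
  apply/seteqP; split => t /=; rewrite !in_itv/= !andbT gt_max.
    by case=> -> ->.
  by case/andP.
- by move=> n; exists (- n%:R).
- rewrite -subTset => t _; exists (Num.bound `|t|) => //=.
  rewrite in_itv/= andbT ltrNl (le_lt_trans _ (archi_boundP (normr_ge0 t)))//.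
  by rewrite -normrN ler_norm.
- move=> _ [x ->]; rewrite /m2 /= /pushforward /mrestr setIC quantile_gt_measure.
  rewrite -[LHS]/(distribution P i `]x, +oo[) -setCitvl.
  by rewrite probability_setC//; exact: measurable_itv.
- move=> n; apply: (le_lt_trans (probability_le1 (distribution P i) _)).
    exact: measurable_itv.
  by rewrite ltry.
Qed.
End Quantile.

Lemma borel_codable_parametrization (R : realType) d (X : measurableType d)
    (P : probability X R) : @borel_codable R _ X ->
  exists2 phi : R -> X, measurable_fun setT phi &
    forall A, measurable A ->
      P A = lebesgue_measure (`[0%R, 1%R]%classic `&` phi @^-1` A).
Proof.
move=> [i [k [mi mk ik]]].
pose mi_ := isMeasurableFun.Build _ _ _ _ i mi.
pose I : {RV P >-> R} := HB.pack i mi_.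
exists (k \o quantile I).
  by apply: measurableT_comp => //; exact: measurable_quantile.
move=> A mA.
have mkA : measurable (k @^-1` A) by rewrite -[X in measurable X]setTI; exact: mk.
rewrite comp_preimage -(quantile_distribution I mkA); congr (P _).
by apply/seteqP; split => x /=; rewrite ik.
Qed.

(** * Orthogonal projections and Lipschitz functions *)

Section Euclid.
Context {R : realType} {n : nat}.
Implicit Types u v w : 'rV[R]_n.

Definition dot u v : R := \sum_(i < n) u 0 i * v 0 i.

Definition nrm u : R := Num.sqrt (dot u u).

Lemma dotC u v : dot u v = dot v u.
Proof. by apply: eq_bigr => i _; rewrite mulrC. Qed.

Lemma dotDl u v w : dot (u + v) w = dot u w + dot v w.
Proof. by rewrite -big_split; apply: eq_bigr => i _; rewrite mxE mulrDl. Qed.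

Lemma dotZl a u v : dot (a *: u) v = a * dot u v.
Proof. by rewrite mulr_sumr; apply: eq_bigr => i _; rewrite mxE mulrA. Qed.

Lemma dotDr u v w : dot w (u + v) = dot w u + dot w v.
Proof. by rewrite dotC dotDl !(dotC w). Qed.

Lemma dotZr a u v : dot v (a *: u) = a * dot v u.
Proof. by rewrite dotC dotZl dotC. Qed.

Lemma dotBl u v w : dot (u - v) w = dot u w - dot v w.
Proof. by rewrite -scaleN1r dotDl dotZl mulN1r. Qed.

Lemma dotBr u v w : dot w (u - v) = dot w u - dot w v.
Proof. by rewrite dotC dotBl !(dotC w). Qed.

Lemma dot0r u : dot u 0 = 0.
Proof. by rewrite -(scale0r 0) dotZr mul0r. Qed.

Lemma dot_ge0 u : 0 <= dot u u.
Proof. by apply: sumr_ge0 => i _; rewrite -expr2 sqr_ge0. Qed.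

Lemma dot_eq0 u : dot u u = 0 -> u = 0.
Proof.
move=> /eqP; rewrite psumr_eq0 => [|i _]; last by rewrite -expr2 sqr_ge0.
move=> /allP h; apply/rowP => i; rewrite mxE; apply/eqP.
by have := h i (mem_index_enum _); rewrite -expr2 sqrf_eq0.
Qed.

Lemma nrm_ge0 u : 0 <= nrm u. Proof. exact: sqrtr_ge0. Qed.

Lemma nrm_sqr u : nrm u ^+ 2 = dot u u.
Proof. by rewrite sqr_sqrtr// dot_ge0. Qed.

Lemma cauchy_schwarz u v : dot u v <= nrm u * nrm v.
Proof.
have [u0|u0] := eqVneq (dot u u) 0.
  by rewrite (dot_eq0 u0) dotC dot0r mulr_ge0// nrm_ge0.
have {}u0 : 0 < dot u u by rewrite lt_neqAle eq_sym u0 dot_ge0.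
have h : dot u v ^+ 2 <= (nrm u * nrm v) ^+ 2.
  rewrite exprMn !nrm_sqr -(ler_pM2l u0).
  have := dot_ge0 (dot u u *: v - dot u v *: u).
  rewrite dotBl !dotBr !dotZl !dotZr (dotC v u); nra.
have [d0|d0] := leP 0 (dot u v).
  by rewrite -(@ler_pXn2r _ 2)// nnegrE// mulr_ge0// nrm_ge0.
by rewrite (le_trans (ltW d0))// mulr_ge0// nrm_ge0.
Qed.

Lemma ler_nrmD u v : nrm (u + v) <= nrm u + nrm v.
Proof.
have h : nrm (u + v) ^+ 2 <= (nrm u + nrm v) ^+ 2.
  rewrite sqrrD !nrm_sqr dotDl !dotDr (dotC v u).
  by have := cauchy_schwarz u v; rewrite -mulr_natr; lra.
by rewrite -(@ler_pXn2r _ 2)// nnegrE ?addr_ge0// nrm_ge0.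
Qed.

Lemma nrmN u : nrm (- u) = nrm u.
Proof. by rewrite /nrm -scaleN1r dotZl dotZr mulrA mulrNN !mul1r. Qed.

Definition proj (us : seq 'rV[R]_n) v : 'rV[R]_n := \sum_(u <- us) dot u v *: u.

Fixpoint orthonormal (us : seq 'rV[R]_n) : Prop :=
  if us is u :: us' then
    [/\ dot u u = 1, forall w, w \in us' -> dot u w = 0 & orthonormal us']
  else True.

Lemma orthonormal_dot us u : orthonormal us -> u \in us -> dot u u = 1.
Proof.
elim: us => [//|a us IH] /= [aa _ o]; rewrite inE => /predU1P[->//|].
exact: IH.
Qed.

Lemma projD us v w : proj us (v + w) = proj us v + proj us w.
Proof.
by rewrite /proj -big_split; apply: eq_bigr => u _; rewrite dotDr scalerDl.
Qed.

Lemma projB us v w : proj us (v - w) = proj us v - proj us w.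
Proof. by apply/(addIr (proj us w)); rewrite subrK -projD subrK. Qed.

Lemma dot_proj_orth us u v : (forall w, w \in us -> dot u w = 0) ->
  dot u (proj us v) = 0.
Proof.
elim: us => [|a us IH] h; rewrite /proj ?big_nil ?dot0r// big_cons dotDr dotZr.
rewrite (h a) ?mem_head// mulr0 add0r; apply: IH => w wus.
by apply: h; rewrite inE wus orbT.
Qed.

Lemma dot_proj us u v : orthonormal us -> u \in us -> dot u (proj us v) = dot u v.
Proof.
elim: us => [//|a us IH] [aa ao o]; rewrite inE /proj big_cons dotDr dotZr.
move=> /predU1P[->|uus].
  by rewrite aa mulr1 -[X in _ + X]/(dot a (proj us v)) dot_proj_orth// addr0.
by rewrite [dot u a]dotC (ao u uus) mulr0 add0r; exact: IH.
Qed.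

Lemma dot_proj_proj us v : orthonormal us ->
  dot (proj us v) (proj us v) = \sum_(u <- us) dot u v ^+ 2.
Proof.
elim: us => [|a us IH]; first by rewrite /proj !big_nil dot0r.
move=> [aa ao o].
have -> : proj (a :: us) v = dot a v *: a + proj us v by rewrite /proj big_cons.
rewrite big_cons -IH// dotDl !dotDr !dotZl !dotZr aa (dotC (proj us v)).
by rewrite dot_proj_orth// mulr0 addr0 add0r mulr1 expr2.
Qed.

Lemma dot_projl us v : dot (proj us v) v = \sum_(u <- us) dot u v ^+ 2.
Proof.
elim: us => [|a us IH]; first by rewrite /proj !big_nil dotC dot0r.
by rewrite [in RHS]big_cons -IH /proj big_cons dotDl dotZl expr2.
Qed.

Lemma nrm_proj_le us v : orthonormal us -> nrm (proj us v) <= nrm v.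
Proof.
move=> o; rewrite ler_sqrt ?dot_ge0//.
have := dot_ge0 (v - proj us v).
rewrite dotBl !dotBr (dotC v) dot_projl dot_proj_proj//; lra.
Qed.

(** The size bound is what counts later: the noise in the span is paid for once per basis vector. A
    vector already in the span adds none. *)
Lemma gram_schmidt (c : seq 'rV[R]_n) : exists us,
  [/\ (size us <= size c)%N, orthonormal us & forall v, v \in c -> proj us v = v].
Proof.
elim: c => [|v c [us [sus o pc]]]; first by exists [::].
have [w0|w0] := eqVneq (v - proj us v) 0.
  exists us; split => //; first exact: leqW.
  move=> x; rewrite inE => /predU1P[->|/pc//].
  by apply/esym/eqP; rewrite -subr_eq0 w0.
set w := v - proj us v in w0.
have ww : 0 < dot w w.
  rewrite lt_neqAle dot_ge0 andbT eq_sym; apply: contra w0 => /eqP/dot_eq0 ->//.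
have wus u : u \in us -> dot w u = 0.
  by move=> uus; rewrite dotC dotBr dot_proj// subrr.
have nw : nrm w != 0 by rewrite gt_eqF// sqrtr_gt0.
pose a := (nrm w)^-1 *: w.
have aus u : u \in us -> dot a u = 0 by move=> /wus h; rewrite dotZl h mulr0.
exists (a :: us); split => //=.
  by split => //; rewrite dotZl dotZr -nrm_sqr mulrA -invfM -expr2 mulVf// expf_neq0.
have pa x : proj (a :: us) x = dot a x *: a + proj us x by rewrite /proj big_cons.
move=> x; rewrite inE pa => /predU1P[->|xc].
  rewrite dotZl.
  (* The residual [w] is orthogonal to the projection of [v], so the component of [v] along [a] is
     exactly [w]. *)
  have -> : dot w v = nrm w ^+ 2.
    by rewrite nrm_sqr -[in LHS](subrK (proj us v) v) dotDr dot_proj_orth// addr0.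
  by rewrite scalerA expr2 mulrA mulVf// mul1r mulfV// scale1r subrK.
by rewrite pc// -{1}(pc _ xc) dot_proj_orth// scale0r add0r.
Qed.

End Euclid.

Section EuclTuple.
Context {R : realType} {n : nat}.
Implicit Types x y z : n.-tuple R.

Definition row_of x : 'rV[R]_n := \row_i tnth x i.

Definition tuple_of_row (v : 'rV[R]_n) : n.-tuple R := [tuple v 0 i | i < n].

Lemma row_of_tuple (v : 'rV[R]_n) : row_of (tuple_of_row v) = v.
Proof. by apply/rowP => i; rewrite mxE tnth_mktuple. Qed.

Lemma tuple_of_row_of x : tuple_of_row (row_of x) = x.
Proof. by apply: eq_from_tnth => i; rewrite tnth_mktuple mxE. Qed.

Lemma row_of_tadd x y : row_of (tadd x y) = row_of x + row_of y.
Proof. by apply/rowP => i; rewrite !mxE tnth_mktuple. Qed.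

Lemma eucl_nrm x y : eucl x y = nrm (row_of x - row_of y).
Proof.
by rewrite /eucl /nrm; congr Num.sqrt; apply: eq_bigr => i _; rewrite !mxE expr2.
Qed.

Lemma eucl_sym x y : eucl x y = eucl y x.
Proof. by rewrite !eucl_nrm -nrmN opprB. Qed.

Lemma euclxx x : eucl x x = 0.
Proof. by rewrite eucl_nrm subrr /nrm dot0r sqrtr0. Qed.

Lemma eucl_triangle y x z : eucl x z <= eucl x y + eucl y z.
Proof. by rewrite !eucl_nrm -(subrKA (row_of y)); exact: ler_nrmD. Qed.

Lemma eucl_eq0 x y : eucl x y = 0 -> x = y.
Proof.
move=> h; have h2 : dot (row_of x - row_of y) (row_of x - row_of y) = 0.
  by rewrite -nrm_sqr -eucl_nrm h expr0n.
have /eqP := dot_eq0 h2; rewrite subr_eq0 => /eqP e.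
by rewrite -[x]tuple_of_row_of e tuple_of_row_of.
Qed.

Lemma eucl_tadd2l x y z : eucl (tadd x y) (tadd x z) = eucl y z.
Proof. by rewrite !eucl_nrm !row_of_tadd opprD addrACA subrr add0r. Qed.

Lemma eucl_tadd2r x y z : eucl (tadd x z) (tadd y z) = eucl x y.
Proof. by rewrite !eucl_nrm !row_of_tadd opprD addrACA subrr addr0. Qed.

Lemma measurable_eucl x : measurable_fun setT (fun y => eucl y x).
Proof.
apply: (@measurableT_comp _ _ _ _ _ _ (@Num.sqrt R)).
  by apply: continuous_measurable_fun; exact: sqrt_continuous.
apply: measurable_sum => i; apply: measurable_funX; apply: measurable_funB => //.
exact: measurable_tnth.
Qed.

Lemma rat_tuple_dense x (e : R) : 0 < e ->
  exists q : n.-tuple rat, eucl x [tuple ratr (tnth q i) | i < n] < e.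
Proof.
move=> e0; pose d := e / n.+1%:R.
have d0 : 0 < d by rewrite divr_gt0.
have /choice[q hq] : forall i : 'I_n, exists q : rat, `|tnth x i - ratr q| < d.
  move=> i; have : tnth x i - d < tnth x i + d by lra.
  by move=> /rat_in_itvoo[q]; rewrite in_itv/= => h; exists q; rewrite ltr_distlC.
exists [tuple q i | i < n].
rewrite -(@ltr_pXn2r _ 2) ?nnegrE ?eucl_ge0 ?(ltW e0)// eucl_sqr.
apply: (@le_lt_trans _ _ (\sum_(i < n) d ^+ 2)).
  apply: ler_sum => i _; rewrite !tnth_mktuple -real_normK ?num_real//.
  by rewrite ler_pXn2r ?nnegrE ?(ltW d0)// ltW.
rewrite sumr_const card_ord -mulr_natl /d expr_div_n mulrCA.
rewrite gtr_pMr ?exprn_gt0// ltr_pdivrMr ?exprn_gt0// mul1r -natrX ltr_nat.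
by rewrite (leq_trans (ltnSn n))// leq_pmulr.
Qed.

(** The sigma-algebra is the product one, so [g] is exhibited as a countable infimum of measurable
    functions: the cones [g p + eucl x p] over rational points [p], which touch [g] by density. *)
Lemma measurable_Lip1 (g : n.-tuple R -> R) :
  Lip1 setT g -> measurable_fun setT g.
Proof.
move=> gL.
pose r (q : n.-tuple rat) : n.-tuple R := [tuple ratr (tnth q i) | i < n].
pose p k : n.-tuple R := r (odflt [tuple of nseq n 0%Q] (unpickle k)).
pose h k x := g (p k) + eucl x (p k).
have gh k x : g x <= h k x.
  by rewrite -lerBlDl; apply: le_trans (ler_norm _) (gL _ _ I I).
have hl x : has_lbound (range (h ^~ x)) by exists (g x) => _ [k _ <-].
apply: (eq_measurable_fun (fun x => infs (h ^~ x) 0)); last first.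
  apply: (@measurable_fun_infs _ _ _ setT h) => // k.
  by apply: measurable_funD => //; exact: measurable_eucl.
move=> x _; rewrite /infs /=.
have -> : sdrop (h ^~ x) 0 = range (h ^~ x).
  by rewrite /sdrop; apply/seteqP; split => y [k] //= _ <-; exists k.
apply/eqP; rewrite eq_le; apply/andP; split; last first.
  by apply: lb_le_inf; [exists (h 0%N x), 0%N|move=> _ [k _ <-]].
apply/ler_addgt0Pr => e e0.
have [q xq] := @rat_tuple_dense x (e / 2) ltac:(by rewrite divr_gt0).
apply: (@le_trans _ _ (h (pickle q) x)); first by apply: ge_inf => //; exists (pickle q).
rewrite /h /p pickleK /=.
have : g (r q) - g x <= eucl (r q) x by exact: le_trans (ler_norm _) (gL _ _ I I).
rewrite eucl_sym => h1; rewrite -[r q]/([tuple ratr (tnth q i) | i < n]) in h1 *; lra.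
Qed.

Lemma measurable_tadd : measurable_fun setT
  (fun p : n.-tuple R * n.-tuple R => tadd p.1 p.2).
Proof.
apply/measurable_fun_tnthP => i.
apply: (eq_measurable_fun (fun p : n.-tuple R * n.-tuple R => tnth p.1 i + tnth p.2 i)).
  by move=> p _; rewrite /= tnth_mktuple.
apply: measurable_funD.
  by apply: (measurableT_comp (measurable_tnth i)); exact: measurable_fst.
by apply: (measurableT_comp (measurable_tnth i)); exact: measurable_snd.
Qed.

Lemma measurable_taddl x : measurable_fun setT (tadd x).
Proof. exact: (measurableT_comp measurable_tadd (pair1_measurable x)). Qed.

Section McShane.
Variables (S : set (n.-tuple R)) (g : n.-tuple R -> R).
Hypotheses (S_neq0 : S !=set0) (gL : Lip1 S g).

(** The McShane extension, the largest 1-Lipschitz extension of [g] from a nonempty [S]. For [g = 0]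
    it is the distance to [S]. *)
Definition mcshane y := inf [set g s + eucl y s | s in S].

Let gle x y : S x -> S y -> g x <= g y + eucl x y.
Proof.
by move=> Sx Sy; rewrite -lerBlDl; apply: le_trans (ler_norm _) (gL Sx Sy).
Qed.

Let values_neq0 y : [set g s + eucl y s | s in S] !=set0.
Proof. by case: S_neq0 => s Ss; exists (g s + eucl y s), s. Qed.

Let values_lb y : has_lbound [set g s + eucl y s | s in S].
Proof.
case: S_neq0 => s0 Ss0.
exists (g s0 - eucl y s0) => _ [s Ss <-]; rewrite lerBlDr -addrA.
apply: le_trans (gle Ss0 Ss) _; rewrite lerD2l addrC (eucl_sym s0).
by rewrite addrC (eucl_sym y s); exact: eucl_triangle.
Qed.

Lemma mcshane_Lip1 : Lip1 setT mcshane.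
Proof.
have hle x y : mcshane x - mcshane y <= eucl x y.
  rewrite lerBlDr -lerBlDl; apply: lb_le_inf => // _ [s Ss <-].
  rewrite lerBlDl; apply: (@le_trans _ _ (g s + eucl x s)).
    by apply: ge_inf => //; exists s.
  by rewrite addrCA lerD2l; exact: eucl_triangle.
move=> x y _ _; rewrite ler_norml hle andbT lerNl opprB eucl_sym; exact: hle.
Qed.

Lemma mcshaneE x : S x -> mcshane x = g x.
Proof.
move=> Sx; apply/eqP; rewrite eq_le; apply/andP; split.
  by apply: ge_inf => //; exists x => //; rewrite euclxx addr0.
by apply: lb_le_inf => // _ [s Ss <-]; exact: gle.
Qed.

End McShane.

End EuclTuple.

(** * Concentration of the Gaussian noise *)

Section IntegralBounds.
Context d (X : measurableType d) (R : realType) (P : probability X R).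

Lemma chernoff (A : set X) (F : X -> \bar R) : measurable A ->
  measurable_fun setT F -> (forall x, 0 <= F x)%E ->
  (forall x, A x -> 1 <= F x)%E -> (P A <= \int[P]_x F x)%E.
Proof.
move=> mA mF F0 F1; rewrite -(setIT A) -integral_indic//.
apply: ge0_le_integral => //.
  by apply/measurable_EFinP; exact: measurable_indic.
move=> x _; rewrite indicE; case: (boolP (x \in A)) => [|_]; last exact: F0.
by rewrite inE; exact: F1.
Qed.

Lemma integral_gt0 (F : X -> \bar R) : measurable_fun setT F ->
  (forall x, 0 < F x)%E -> (0 < \int[P]_x F x)%E.
Proof.
move=> mF F0; rewrite lt_neqAle integral_ge0 ?andbT; last by move=> x _; exact: ltW.
apply/eqP => i0.
have : ae_eq P setT F (cst 0%E).
  apply/(ae_eq_integral_abs P measurableT mF).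
  by rewrite [RHS]i0; apply: eq_integral => x _; rewrite gee0_abs// ltW.
move=> [N [mN N0 hN]].
have : P setT = 0%E.
  apply/eqP; rewrite eq_le measure_ge0 andbT -N0; apply: le_measure; rewrite ?inE//.
  by move=> x _; apply: hN => /= /(_ I) Fx; have := F0 x; rewrite Fx ltxx.
by rewrite probability_setT => /eqP; rewrite onee_eq0.
Qed.
End IntegralBounds.

Section Corruption.
Context {R : realType} {n : nat} (nu : probability (n.-tuple R) R) (sigma s : R).
Hypotheses (s0 : 0 < s) (sigma_le : `|sigma| <= s).
Local Notation leb := (@lebesgue_measure R).
Local Notation gam := (@gauss R n sigma).
Implicit Types (S : set (n.-tuple R)) (g h : n.-tuple R -> R).

Lemma convolution_product (A : set (n.-tuple R)) :
  convolution nu gam A =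
  product_measure1 nu gam [set p | A (tadd p.1 p.2)].
Proof.
apply: eq_integral => x _ /=; congr gauss.
by apply/seteqP; split => z; rewrite /xsection/= inE.
Qed.

Lemma product_measure_le (A : set (n.-tuple R * n.-tuple R)) (c : \bar R) :
  measurable A -> (forall x, gam (xsection A x) <= c)%E ->
  (product_measure1 nu gam A <= c)%E.
Proof.
move=> mA Ac; apply: (@le_trans _ _ (\int[nu]_x cst c x)%E).
  apply: ge0_le_integral => //; first exact: measurable_fun_xsection.
  by move=> x _; exact: Ac.
by rewrite integral_cst// [X in (_ * X)%E]probability_setT mule1.
Qed.

(** A parametrization of the product law supplies the clean point and the noise together. The last
    clause is conditioning: an event about the clean and corrupted points is no likelier than its
    worst noise probability over fixed [x] in [S]. *)
Lemma corruption_coupling S x0 : measurable S -> S x0 -> nu S = 1%E ->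
  exists phi1 phi2, [/\ parametrization S nu phi1,
    parametrization setT (convolution nu gam) phi2 &
    forall (B : set (n.-tuple R * n.-tuple R)) c, measurable B ->
      (forall x, S x -> gam [set z | B (x, tadd x z)] <= c)%E -> (0 <= c)%E ->
      (leb [set t | (`[0%R, 1%R]%classic : set R) t /\ B (phi1 t, phi2 t)]
        <= c)%E].
Proof.
move=> mS Sx0 nuS.
have [phi mphi phiP] := borel_codable_parametrization (product_measure1 nu gam)
  (borel_codable_prod (borel_codable_tuple n) (borel_codable_tuple n)).
pose phi0 t := (phi t).1.
(* A parametrization must take all its values in [S], while [phi0] does so only almost surely; the
   exceptional null set is sent to [x0]. *)
pose phi1 t := if phi0 t \in S then phi0 t else x0.
pose phi2 t := tadd (phi t).1 (phi t).2.
have m01 : measurable (`[0%R, 1%R]%classic : set R) by exact: measurable_itv.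
have mphi0 : measurable_fun setT phi0.
  by apply: (measurableT_comp _ mphi); exact: measurable_fst.
have mphi2 : measurable_fun setT phi2 by exact: (measurableT_comp measurable_tadd mphi).
have mphi1 : measurable_fun setT phi1.
  apply: measurable_fun_ifT => //; apply: (measurable_fun_bool true).
  rewrite setTI (_ : _ @^-1` _ = phi0 @^-1` S).
    by rewrite -[X in measurable X]setTI; exact: mphi0.
  by apply/seteqP; split => t /=; [exact: set_mem|exact: mem_set].
have phi0P A : measurable A -> leb (`[0%R, 1%R]%classic `&` phi0 @^-1` A) = nu A.
  move=> mA; rewrite -[X in leb (_ `&` X)]/(phi @^-1` (fst @^-1` A)) -phiP; last first.
    by rewrite -[X in measurable X]setTI; exact: measurable_fst.
  rewrite (_ : fst @^-1` A = A `*` setT); last first.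
    by apply/seteqP; split => -[x y] //= [].
  transitivity (nu A * gam setT)%E; first exact: product_measure1E.
  by rewrite probability_setT mule1.
pose N := `[0%R, 1%R]%classic `&` phi0 @^-1` (~` S).
have mN : measurable N.
  apply: measurableI => //; rewrite -[X in measurable X]setTI.
  by apply: mphi0 => //; exact: measurableC.
have N0 : leb N = 0%E.
  by rewrite phi0P ?probability_setC ?nuS ?subee//; exact: measurableC.
have leN (A B : set R) : measurable B -> A `<=` B `|` N -> (leb A <= leb B)%E.
  move=> mB AB; rewrite -(@measureU0 _ _ _ leb B N mB mN N0).
  exact: le_outer_measure.
have pre (g : R -> n.-tuple R) A : measurable_fun setT g -> measurable A ->
    measurable (`[0%R, 1%R]%classic `&` g @^-1` A).
  move=> mg mA; apply: measurableI => //.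
  by rewrite -[X in measurable X]setTI; exact: mg.
exists phi1, phi2; split.
- split; first exact: measurable_funTS.
    by move=> _ [t _ <-]; rewrite /phi1; case: ifPn => //; rewrite inE.
  move=> A mA; rewrite -phi0P//; apply/eqP; rewrite eq_le; apply/andP; split.
    apply: leN; first exact: pre.
    move=> t [t01 At]; have [tS|tS] := pselect (S (phi0 t)); [left|right]; split => //=.
    by rewrite /phi1 mem_set.
  apply: leN; first exact: pre.
  move=> t [t01]; rewrite /= /phi1 => At; have [tS|tS] := pselect (S (phi0 t)); [left|right]; split => //=.
  by move: At; rewrite mem_set.
- split => //; first exact: measurable_funTS.
  move=> A mA; rewrite convolution_product phiP//.
  by rewrite -[X in measurable X]setTI; exact: measurable_tadd.
(* Sections of [B'] over points outside [S] are empty, and there [0 <= c] is the required bound. *)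
move=> B c mB Bc c0; pose B' := [set p | S p.1 /\ B (p.1, tadd p.1 p.2)].
have mB' : measurable B'.
  have -> : B' = (S `*` setT) `&`
      (fun p : n.-tuple R * n.-tuple R => (p.1, tadd p.1 p.2)) @^-1` B.
    by apply/seteqP; split => -[x y] /= [] // -[].
  apply: measurableI; first exact: measurableX.
  rewrite -[X in measurable X]setTI.
  have : measurable_fun setT (fun p : n.-tuple R * n.-tuple R => (p.1, tadd p.1 p.2)).
    apply/measurable_fun_pairP; split; [exact: measurable_fst|exact: measurable_tadd].
  exact.
apply: (@le_trans _ _ (product_measure1 nu gam B')); last first.
  apply: product_measure_le => // x; have [Sx|Sx] := pselect (S x).
    rewrite (_ : xsection B' x = [set z | B (x, tadd x z)]); first exact: Bc.
    by apply/seteqP; split => z; rewrite /xsection/= inE /B'/=; [case|].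
  rewrite (_ : xsection B' x = set0) ?measure0//.
  by rewrite -subset0 => z; rewrite /xsection/= inE /B'/= => -[].
rewrite phiP//; apply: leN.
  by apply: measurableI => //; rewrite -[X in measurable X]setTI; exact: mphi.
move=> t [t01]; rewrite /phi1 => Bt.
have [tS|tS] := pselect (S (phi0 t)); [left|right]; split => //=.
by move: Bt; rewrite mem_set.
Qed.

Section GaussianAverage.
Variables (g : n.-tuple R -> R) (t : R).
Hypotheses (gL : Lip1 setT g) (t0 : 0 < t).

Let E (r : R) x z : \bar R := (expR (r * g (tadd x z)))%:E.

Let L r x : \bar R := (\int[gam]_z E r x z)%E.

Let mg : measurable_fun setT g. Proof. exact: measurable_Lip1. Qed.

Let mE r x : measurable_fun setT (E r x).
Proof.
apply/measurable_EFinP; apply: measurableT_comp => //.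
apply: measurable_funM => //.
exact: (measurableT_comp mg (measurable_taddl x)).
Qed.

Let E0 r x z : (0 < E r x z)%E. Proof. by rewrite lte_fin expR_gt0. Qed.

Let L0 r x : (0 < L r x)%E. Proof. exact: integral_gt0. Qed.

(** Property (tau) for [exp(t g)] and [exp(- t g) / k], with [k = exp(t^2 s^2)] absorbing the loss
    in the cost condition. *)
Let LL x : (L t x * L (- t) x <= (expR (t ^+ 2 * s ^+ 2))%:E)%E.
Proof.
set k := expR _; have k0 : 0 < k by exact: expR_gt0.
rewrite -[k%:E]mul1e -lee_pdivrMr// -muleA.
have -> : (L (- t) x * (k^-1)%:E = \int[gam]_z (E (- t) x z * (k^-1)%:E))%E.
  rewrite ge0_integralZr//=; first by move=> z _; exact: ltW.
  by rewrite lee_fin invr_ge0 ltW.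
apply: (gauss_property_tau s0 sigma_le) => //.
- by apply: emeasurable_funM.
- by move=> z; exact: ltW.
- by move=> z; rewrite mule_ge0// ?ltW// lte_fin invr_gt0.
move=> p q; rewrite -!EFinM lee_fin /k -expRN -!expRD ler_expR.
have : g (tadd x p) - g (tadd x q) <= eucl p q.
  by apply: le_trans (ler_norm _) _; rewrite -(eucl_tadd2l x); exact: gL.
move=> h; have {}h := ler_wpM2l (ltW t0) h.
apply: (@le_trans _ _ (t * eucl p q - t ^+ 2 * s ^+ 2)); first by move: h; rewrite mulrBr; lra.
(* The linear growth [t * eucl p q] is traded for the quadratic cost by completing a square. *)
have := sqr_ge0 (eucl p q / (2 * s) - t * s).
have -> : (eucl p q / (2 * s) - t * s) ^+ 2 =
    eucl p q ^+ 2 / (4 * s ^+ 2) - t * eucl p q + t ^+ 2 * s ^+ 2.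
  by field; rewrite gt_eqF.
by lra.
Qed.

Let L_fin r x : `|r| = t -> L r x = (fine (L r x))%:E.
Proof.
move=> rt; rewrite fineK// ge0_fin_numE ?(ltW (L0 _ _))// ltey; apply/eqP => Loo.
have := LL x; move: rt; rewrite /Order.le.
have [r0|r0] := leP 0 r => rt.
  by rewrite -rt ger0_norm// Loo gt0_mulye.
by rewrite -rt ltr0_norm// opprK Loo gt0_muley.
Qed.

Let Lt_fin x : L t x = (fine (L t x))%:E.
Proof. by apply: L_fin; rewrite gtr0_norm. Qed.

Let Lt_gt0 x : 0 < fine (L t x).
Proof. by rewrite -lte_fin -Lt_fin. Qed.

(* The Lipschitz function on the clean space matched with [g]: Maurey's
   inequality bounds both exponential moments of [g (x + z) - log_average x],
   and proves at the same time that they are finite. *)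
Definition log_average x : R := ln (fine (L t x)) / t.

Let expR_log_average x : expR (t * log_average x) = fine (L t x).
Proof. by rewrite /log_average mulrC divfK ?gt_eqF// lnK// posrE. Qed.

(** For every noise value, moving from [y] to [x] raises [g] by at most [eucl x y], hence multiplies
    the exponential average by at most [exp(t * eucl x y)]. *)
Lemma log_average_Lip1 : Lip1 setT log_average.
Proof.
have h x y : log_average x - log_average y <= eucl x y.
  rewrite lerBlDl -(ler_pM2l t0) -ler_expR expR_log_average mulrDr expRD.
  rewrite expR_log_average -lee_fin EFinM -!Lt_fin muleC.
  rewrite -[X in (_ <= _ * X)%E]/(\int[gam]_z E t y z)%E.
  rewrite -ge0_integralZl//=; last by move=> z _; exact: ltW.
  apply: ge0_le_integral => //.
  - by move=> z _; exact: ltW.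
  - by apply: emeasurable_funM.
  move=> z _; rewrite -EFinM lee_fin -expRD ler_expR -mulrDr ler_pM2l//.
  rewrite -lerBlDr; apply: le_trans (ler_norm _) _.
  by rewrite -(eucl_tadd2r x y z); exact: gL.
move=> x y _ _; rewrite ler_norml; have := h x y; have := h y x.
by rewrite (eucl_sym y) => h1 ->; rewrite lerNl opprB h1.
Qed.

(** One Chernoff bound per tail. Where [g] is large, normalization by [exp(- t a)] is exact and
    leaves [exp(- t e)]; where [g] is small, the factor [exp(t a)] equals [L t x], and [LL] bounds
    the product. *)
Lemma log_average_concentration e x :
  (gam [set z | (e < `|log_average x - g (tadd x z)|)%R] <=
    (2 * expR (t ^+ 2 * s ^+ 2 - t * e))%:E)%E.
Proof.
have [a aE] : exists a, a = log_average x by exists (log_average x).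
rewrite -aE.
have mgx : measurable_fun setT (fun z => g (tadd x z)).
  exact: (measurableT_comp mg (measurable_taddl x)).
have mlt (u v : n.-tuple R -> R) : measurable_fun setT u -> measurable_fun setT v ->
    measurable [set z | u z < v z].
  move=> mu_ mv; rewrite (_ : [set z | _] = (fun z => u z < v z) @^-1` [set true]).
    by rewrite -[X in measurable X]setTI; exact: measurable_fun_ltr.
  by apply/seteqP; split.
have m1 : measurable [set z | e < g (tadd x z) - a].
  by apply: mlt => //; exact: measurable_funB.
have m2 : measurable [set z | e < a - g (tadd x z)].
  by apply: mlt => //; exact: measurable_funB.
have mm : measurable [set z | e < `|a - g (tadd x z)|].
  by apply: mlt => //; apply: measurableT_comp => //; exact: measurable_funB.
apply: (@le_trans _ _ (gam [set z | (e < g (tadd x z) - a)%R] +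
    gam [set z | (e < a - g (tadd x z))%R])%E).
  apply: le_trans (measureU2 _ m1 m2); apply: le_measure; rewrite ?inE//.
    exact: measurableU.
  move=> z /=; rewrite ltr_normr opprB => /orP[h|h]; [by right|by left].
rewrite mulr_natl mulr2n EFinD; apply: leeD.
  apply: (@le_trans _ _ (\int[gam]_z ((expR (- t * (a + e)))%:E * E t x z))%E).
    apply: chernoff => //; first by apply: emeasurable_funM.
      by move=> z; rewrite mule_ge0// ?ltW// lee_fin expR_ge0.
    move=> z /= ez; rewrite -EFinM -expRD lee_fin -expR0 ler_expR.
    have : 0 <= t * (g (tadd x z) - a - e) by rewrite mulr_ge0 ?(ltW t0)//; lra.
    by rewrite !mulrBr mulrDr; lra.
  rewrite ge0_integralZl//=; last first.
    by move=> z _; exact: ltW.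
  rewrite -[X in (_ * X)%E]/(L t x) Lt_fin -expR_log_average -aE -EFinM -expRD lee_fin ler_expR.
  by rewrite mulrDr; have := mulr_ge0 (sqr_ge0 t) (sqr_ge0 s); lra.
apply: (@le_trans _ _ (\int[gam]_z ((expR (t * (a - e)))%:E * E (- t) x z))%E).
  apply: chernoff => //; first by apply: emeasurable_funM.
    by move=> z; rewrite mule_ge0// ?ltW// lee_fin expR_ge0.
  move=> z /= ez; rewrite -EFinM -expRD lee_fin -expR0 ler_expR.
  have : 0 <= t * (a - g (tadd x z) - e) by rewrite mulr_ge0 ?(ltW t0)//; lra.
  by rewrite !mulrBr; lra.
rewrite ge0_integralZl//=; last by move=> z _; exact: ltW.
rewrite -[X in (_ * X)%E]/(L (- t) x) mulrBr expRD aE expR_log_average EFinM -Lt_fin.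
rewrite muleAC expRD EFinM; apply: lee_pmul => //.
by rewrite mule_ge0// ltW.
Qed.

End GaussianAverage.

(** Markov's inequality for the squared norm, a sum of one second moment per basis vector. *)
Lemma nrm_proj_gauss (us : seq 'rV[R]_n) e : orthonormal us -> 0 < e ->
  (gam [set z | (e < nrm (proj us (row_of z)))%R] <=
    ((size us)%:R * (s ^+ 2 * (2 * expR 2^-1)) / e ^+ 2)%:E)%E.
Proof.
move=> o e0.
pose q z : \bar R := (\sum_(u <- us) ((\sum_(i < n) u 0 i * tnth z i) ^+ 2)%:E)%E.
have mdot (u : 'rV[R]_n) : measurable_fun setT
    (fun z : n.-tuple R => ((\sum_(i < n) u 0 i * tnth z i) ^+ 2)%:E).
  by apply/measurable_EFinP; apply: measurable_funX; exact: measurable_lin.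
have mq : measurable_fun setT q by apply: emeasurable_sum.
have q0 z : (0 <= q z)%E by apply: sume_ge0 => u _; rewrite lee_fin sqr_ge0.
have qE z : q z = (nrm (proj us (row_of z)) ^+ 2)%:E.
  rewrite nrm_sqr dot_proj_proj// /q sumEFin; congr EFin; apply: eq_bigr => u _.
  by congr (_ ^+ 2); apply: eq_bigr => i _; rewrite mxE.
apply: (@le_trans _ _ (\int[gam]_z ((e ^- 2)%:E * q z))%E).
  apply: chernoff.
  - have -> : [set z | e < nrm (proj us (row_of z))] = [set z | ((e ^+ 2)%:E < q z)%E].
      apply/seteqP; split => z /=; rewrite qE lte_fin ltr_pXn2r ?nnegrE ?nrm_ge0 ?(ltW e0)//.
    rewrite -[X in measurable X]setTI; exact: emeasurable_fun_o_infty.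
  - by apply: emeasurable_funM.
  - by move=> z; rewrite mule_ge0// lee_fin invr_ge0 sqr_ge0.
  move=> z /= ez; rewrite qE -EFinM lee_fin mulrC ler_pdivlMr ?exprn_gt0// mul1r.
  by rewrite ler_pXn2r ?nnegrE ?nrm_ge0 ?(ltW e0)// ltW.
rewrite ge0_integralZl//=; last by rewrite lee_fin invr_ge0 sqr_ge0.
rewrite mulrC EFinM lee_wpmul2l//; first by rewrite lee_fin invr_ge0 sqr_ge0.
rewrite ge0_integral_sum//=; last by move=> u z _; rewrite lee_fin sqr_ge0.
apply: (@le_trans _ _ (\sum_(u <- us) (s ^+ 2 * (2 * expR 2^-1))%:E)%E).
  rewrite big_seq [leRHS]big_seq; apply: lee_sum => u uus.
  apply: (gauss_second_moment s0 sigma_le).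
  rewrite -(orthonormal_dot o uus); apply: eq_bigr => i _; by rewrite expr2.
rewrite sumEFin lee_fin.
by rewrite big_const_seq count_predT iter_addr_0 -[leLHS]mulr_natl.
Qed.

End Corruption.

(** * The Gromov distance to the corrupted space *)

Section Distance.
Context {R : realType}.
Local Notation leb := (@lebesgue_measure R).

(** [me1] is an infimum, so a strict bound by [e] is obtained from the admissible value [e / 2]. *)
Lemma me1_lt (u v : R -> R) e : 0 < e ->
  (leb [set t | (`[0%R, 1%R]%classic : set R) t /\ (e / 2 < `|u t - v t|)%R]
    < (e / 2)%:E)%E ->
  me1 u v < e.
Proof.
move=> e0 h; apply: (@le_lt_trans _ _ (e / 2)); last by lra.
apply: ge_inf; first by exists 0 => x [/ltW].
by split => //; rewrite divr_gt0.
Qed.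

(** Each matching may err by [e / 2]. For functions on [S], [e / 4] pays for moving [x] to its
    projection (twice the net radius [e / 8]) and [e / 4] for the projected noise. *)
Lemma dconc_corruption_le n (S : set (n.-tuple R)) (nu : probability (n.-tuple R) R)
    (sigma s t e : R) (x0 : n.-tuple R) (c : seq (n.-tuple R)) :
  0 < s -> `|sigma| <= s -> 0 < t -> 0 < e ->
  measurable S -> S x0 -> nu S = 1%E ->
  (forall a, S a -> exists2 x, x \in c & eucl x a < e / 8) ->
  2 * expR (t ^+ 2 * s ^+ 2 - t * (e / 2)) < e / 2 ->
  (size c)%:R * (s ^+ 2 * (2 * expR 2^-1)) / (e / 4) ^+ 2 < e / 2 ->
  dconc S nu setT (convolution nu (gauss sigma)) <= e.
Proof.
move=> s0 ss t0 e0 mS Sx0 nuS Sc small1 small2.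
have [phi1 [phi2 [p1 p2 coupling]]] := corruption_coupling sigma mS Sx0 nuS.
have mlt (u v : n.-tuple R -> R) : Lip1 setT u -> Lip1 setT v ->
    measurable [set p : n.-tuple R * n.-tuple R | e / 2 < `|u p.1 - v p.2|].
  move=> uL vL; rewrite (_ : [set p | _] =
      (fun p : n.-tuple R * n.-tuple R => e / 2 < `|u p.1 - v p.2|) @^-1` [set true]).
    rewrite -[X in measurable X]setTI; apply: measurable_fun_ltr => //.
    apply: measurableT_comp => //; apply: measurable_funB.
      by apply: (measurableT_comp (measurable_Lip1 uL)); exact: measurable_fst.
    by apply: (measurableT_comp (measurable_Lip1 vL)); exact: measurable_snd.
  by apply/seteqP; split.
apply: ge_inf; first by exists 0 => x [/ltW].
split => //; exists phi1, phi2; split => // [g1 g1L|g2 g2L].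
- have [us [sus o pus]] := gram_schmidt (map row_of c).
  have S0 : S !=set0 by exists x0.
  pose h := mcshane S g1.
  have hL : Lip1 setT h by exact: mcshane_Lip1.
  pose Q y := tuple_of_row (proj us (row_of y)).
  have QL x y : eucl (Q x) (Q y) <= eucl x y.
    by rewrite !eucl_nrm !row_of_tuple -projB nrm_proj_le.
  (* Projected points may leave [S], which is why [g1] is extended before being composed with
     [Q]. *)
  exists (h \o Q).
    by move=> x y _ _; apply: le_trans (hL _ _ I I) (QL _ _).
  have QhL : Lip1 setT (h \o Q).
    by move=> x y _ _; apply: le_trans (hL _ _ I I) (QL _ _).
  apply: me1_lt => //; move: small2; rewrite -lte_fin; apply: le_lt_trans.
  pose B := [set p : n.-tuple R * n.-tuple R | e / 2 < `|h p.1 - (h \o Q) p.2|].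
  have mB : measurable B by exact: mlt.
  rewrite (_ : [set t | _] =
      [set t | (`[0%R, 1%R]%classic : set R) t /\ B (phi1 t, phi2 t)]); last first.
    have hE r : (`[0%R, 1%R]%classic : set R) r -> h (phi1 r) = g1 (phi1 r).
      by move=> r01; case: p1 => _ im _; apply: mcshaneE => //; apply: im; exists r.
    by apply/seteqP; split => r [r01]; rewrite /B/= hE.
  apply: coupling => // [x Sx|]; last first.
    by rewrite lee_fin divr_ge0 ?sqr_ge0// mulr_ge0// mulr_ge0 ?sqr_ge0// mulr_ge0// expR_ge0.
  have e4 : 0 < e / 4 by rewrite divr_gt0.
  apply: (@le_trans _ _ (gauss sigma [set z : n.-tuple R | (e / 4 < nrm (proj us (row_of z)))%R])).
    apply: le_measure; rewrite ?inE.
    + have mp : measurable_fun setT (fun z : n.-tuple R => (x, tadd x z)).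
        by apply/measurable_fun_pairP; split; [exact: measurable_cst|exact: measurable_taddl].
      by have := mp measurableT _ mB; rewrite setTI.
    (* The norm of the projection is the distance from [Q z] to the origin, a 1-Lipschitz function
       of [z], hence measurable. *)
    + rewrite (_ : [set z | _] = (fun z => e / 4 < eucl (Q z) (tuple_of_row 0)) @^-1` [set true]).
        rewrite -[X in measurable X]setTI; apply: measurable_fun_ltr => //.
        apply: measurable_Lip1 => y z _ _.
        apply: (@le_trans _ _ (eucl (Q y) (Q z))) => //.
        rewrite ler_norml lerNl opprB !lerBlDr; apply/andP; split.
          by rewrite (eucl_sym (Q y)); exact: eucl_triangle.
        exact: eucl_triangle.
      by apply/seteqP; split => z; rewrite /= eucl_nrm !row_of_tuple subr0.
    move=> z; rewrite /B/= => hB.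
    have {}hB := lt_le_trans hB (hL _ _ I I).
    have [y yc yx] := Sc _ Sx.
    have py : Q y = y.
      by rewrite /Q pus ?tuple_of_row_of//; exact: map_f.
    (* The net point [y] is fixed by [Q], so it lies within [e / 8] of both [x] and [Q x]. *)
    have d1 : eucl x (Q x) < e / 4.
      apply: le_lt_trans (eucl_triangle y _ _) _.
      rewrite (eucl_sym x) -{2}py.
      have := QL y x; lra.
    have d2 : eucl (Q x) (Q (tadd x z)) = nrm (proj us (row_of z)).
      by rewrite eucl_sym eucl_nrm !row_of_tuple -projB row_of_tadd addrC addKr.
    have := eucl_triangle (Q x) x (Q (tadd x z)).
    rewrite d2; lra.
  apply: le_trans (nrm_proj_gauss s0 ss o e4) _.
  rewrite lee_fin ler_pM2r ?invr_gt0 ?exprn_gt0// ler_wpM2r//.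
  + by rewrite mulr_ge0 ?sqr_ge0// mulr_ge0// expR_ge0.
  + by rewrite ler_nat (leq_trans sus)// size_map.
- pose g1 := log_average sigma g2 t.
  have g1L : Lip1 setT g1 by exact: (log_average_Lip1 s0 ss).
  exists g1; first by move=> x y _ _; exact: g1L.
  apply: me1_lt => //; move: small1; rewrite -lte_fin; apply: le_lt_trans.
  apply: (coupling [set p | e / 2 < `|g1 p.1 - g2 p.2|]); first exact: mlt.
    by move=> x _; exact: (log_average_concentration s0 ss).
  by rewrite lee_fin mulr_ge0// expR_ge0.
Qed.

Lemma covering_number_lt n (A : set (n.-tuple R)) e (r : R) :
  (covering_number A e < r%:E)%E -> exists2 c : seq (n.-tuple R),
    (size c)%:R < r & forall a, A a -> exists2 x, x \in c & eucl x a < e.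
Proof.
by move=> /ereal_inf_lt[_ [c Ac <-]]; rewrite lte_fin => cr; exists c.
Qed.

End Distance.

(** * Measurability of the embeddings and of their images *)

Section ContinuousImage.
Context {R : realType} {T : ptopologicalType} {n : nat} (f : T -> n.-tuple R).
Hypothesis f_continuous : forall x (e : R), 0 < e ->
  \forall y \near x, eucl (f x) (f y) < e.

Lemma tnth_le_eucl (x y : n.-tuple R) i : `|tnth x i - tnth y i| <= eucl x y.
Proof.
rewrite -sqrtr_sqr ler_sqrt; last by apply: sumr_ge0 => j _; exact: sqr_ge0.
by rewrite (bigD1 i)//= lerDl; apply: sumr_ge0 => j _; exact: sqr_ge0.
Qed.

Lemma measurable_continuous_tuple :
  measurable_fun setT (f : g_sigma_algebraType (@open T) -> n.-tuple R).
Proof.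
apply/measurable_fun_tnthP => i mT.
apply: (measurability _ (RGenOInfty.measurableE R)) => //.
move=> _ [_ [r ->] <-]; rewrite setTI; apply: sub_sigma_algebra.
rewrite openE => x /=; rewrite in_itv/= andbT => rx.
have : 0 < tnth (f x) i - r by rewrite subr_gt0.
move=> /(f_continuous x); apply: filterS => y xy /=; rewrite in_itv/= andbT.
have := le_lt_trans (tnth_le_eucl (f x) (f y) i) xy.
by rewrite ltr_norml => /andP[_]; lra.
Qed.

(** The range is the zero set of the distance to it, which is 1-Lipschitz; compactness makes the
    distance attained, so distance 0 means membership. *)
Lemma measurable_range_compact : compact [set: T] -> measurable (range f).
Proof.
move=> cT; pose D := mcshane (range f) (cst 0 : n.-tuple R -> R).
have f0 : range f !=set0 by exists (f point), point.
have zL : Lip1 (range f) (cst 0 : n.-tuple R -> R).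
  by move=> x y _ _; rewrite subrr normr0 eucl_ge0.
have mD : measurable_fun setT D by apply: measurable_Lip1; exact: mcshane_Lip1.
have -> : range f = D @^-1` [set 0].
  apply/seteqP; split => y; first by move=> fy; rewrite /= /D mcshaneE.
  move=> /= Dy.
  have cont : {within [set: T], continuous (fun x => eucl y (f x))}.
    apply: continuous_subspaceT => x; apply/cvgrPdist_lt => e e0.
    apply: filterS (f_continuous x e0) => z xz; apply: le_lt_trans xz.
    rewrite ler_norml lerNl opprB !lerBlDr; apply/andP; split.
      by rewrite addrC; exact: eucl_triangle.
    by rewrite addrC (eucl_sym (f x)); exact: eucl_triangle.
  have T0 : [set: T] !=set0 by exists point.
  have [a _ amin] := compact_EVT_min T0 cT cont.
  exists a => //; apply/esym/eucl_eq0/eqP; rewrite eq_le eucl_ge0 andbT -Dy.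
  apply: lb_le_inf; first by exists (0 + eucl y (f point)), (f point) => //; exists point.
  by move=> _ [_ [x _ <-] <-]; rewrite /= add0r; apply: amin; rewrite inE.
rewrite -[X in measurable X]setTI; apply: mD => //; exact: measurable_set1.
Qed.

End ContinuousImage.

Unset Implicit Arguments.

Theorem theorem11 (R : realType) (T : ptopologicalType)
  (mu : probability (g_sigma_algebraType (@open T)) R)
  (f : forall d : nat, T -> d.-tuple R) (sigma : nat -> R) :
  @topological_manifold R T ->
  compact [set: T] ->
  (\forall d \near \oo, embedding (f d)) ->
  (forall e : R, 0 < e ->
     (fun d : nat => (covering_number (range (f d)) e * ((d%:R)^-1)%:E)%E)
       @ \oo --> 0%E) ->
  (exists C : R, \forall d \near \oo, `|sigma d| <= C / Num.sqrt (d%:R)) ->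
  (fun d : nat =>
     dconc (range (f d)) (pushforward mu (f d))
           [set: d.-tuple R]
           (convolution (pushforward mu (f d)) (@gauss R d (sigma d))))
    @ \oo --> 0.
Proof.
move=> _ cT femb covf [C sigmaC].
apply/cvgrPdist_lt => eps eps0.
pose e := eps / 2; have e0 : 0 < e by rewrite divr_gt0.
(* Chosen so that [t * (e / 2) = 2 + |ln (e / 4)|]: once [t^2 s^2 <= 1], the exponent is at most
   [- 1 - |ln (e / 4)|], below [ln (e / 4)]. *)
pose t := 2 * (2 + `|ln (e / 4)|) / e.
have t0 : 0 < t by rewrite divr_gt0// mulr_gt0// ltr_wpDr.
(* The added 1 keeps the dominating scale [s] positive, even when [sigma d] or [C] vanishes. *)
pose K := `|C| + 1; have K0 : 0 < K by rewrite ltr_wpDl.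
pose k : R := 2 * expR 2^-1; have k0 : 0 < k by rewrite mulr_gt0// expR_gt0.
(* Solves the projected-noise condition for the ratio of net size to [d], with [s^2 = K^2 / d]
   inserted. *)
pose delta := e / 2 * (e / 4) ^+ 2 / (K ^+ 2 * k).
have delta0 : 0 < delta.
  by rewrite divr_gt0 ?mulr_gt0 ?exprn_gt0 ?divr_gt0.
have e8 : 0 < e / 8 by rewrite divr_gt0.
have cov_small : \forall d \near \oo,
    (covering_number (range (f d)) (e / 8) * ((d%:R)^-1)%:E < delta%:E)%E.
  have := covf _ e8 => /(_ [set y | (y < delta%:E)%E]); apply.
  apply: open_nbhs_nbhs.
  by split; [exact: open_ereal_lt_ereal|rewrite /= lte_fin].
near=> d.
have d0 : 0 < (d%:R : R) by near: d; exact: nbhs_infty_gtr.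
have [finj fcont finv] : embedding (f d) by near: d.
pose s := K / Num.sqrt d%:R.
have s0 : 0 < s by rewrite divr_gt0// sqrtr_gt0.
have ss : `|sigma d| <= s.
  apply: (@le_trans _ _ (C / Num.sqrt d%:R)); first by near: d.
  rewrite ler_pM2r ?invr_gt0 ?sqrtr_gt0// (le_trans (ler_norm _))//.
  by rewrite lerDl.
have s2 : s ^+ 2 = K ^+ 2 / d%:R by rewrite expr_div_n sqr_sqrtr// ltW.
have ts : t ^+ 2 * s ^+ 2 <= 1.
  rewrite s2 mulrA ler_pdivrMr// mul1r.
  by near: d; exact: nbhs_infty_ger.
have : (covering_number (range (f d)) (e / 8) < (delta * d%:R)%:E)%E.
  rewrite EFinM -lte_pdivrMr//.
  by near: d; exact: cov_small.
move=> /covering_number_lt[c cd cP].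
pose mf := isMeasurableFun.Build _ _ _ _ _ (measurable_continuous_tuple fcont).
pose F : {mfun (g_sigma_algebraType (@open T)) >-> d.-tuple R} :=
  HB.pack (f d : g_sigma_algebraType (@open T) -> d.-tuple R) mf.
have fx0 : range (f d) (f d point) by exists point.
have F1 : distribution mu F (range (f d)) = 1%E.
  by rewrite /distribution /pushforward preimage_range probability_setT.
have := @dconc_corruption_le R d (range (f d)) (distribution mu F) (sigma d)
  s t e _ c s0 ss t0 e0 (measurable_range_compact fcont cT) fx0 F1 cP.
set x := dconc _ _ _ _ => h.
(* Convergence concerns the absolute value; the infimum of an empty set is 0 by convention, so that
   case is covered too. *)
have x0 : 0 <= x.
  rewrite /x /dconc; set E := [set _ | _].
  have [->|/set0P E0] := eqVneq E set0; first by rewrite inf0.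
  by apply: lb_le_inf => // y [/ltW].
rewrite sub0r normrN ger0_norm//; apply: (@le_lt_trans _ _ e); last by rewrite /e; lra.
apply: h.
  suff h : expR (t ^+ 2 * s ^+ 2 - t * (e / 2)) < e / 4 by lra.
  rewrite -[ltRHS]lnK ?posrE ?divr_gt0// ltr_expR.
  have -> : t * (e / 2) = 2 + `|ln (e / 4)| by rewrite /t; field; rewrite gt_eqF.
  by have := lerNnormlW (lexx `|ln (e / 4)|); lra.
rewrite -/k s2 ltr_pdivrMr ?exprn_gt0 ?divr_gt0//.
have -> : (size c)%:R * (K ^+ 2 / d%:R * k) = (size c)%:R / d%:R * (K ^+ 2 * k).
  by field; rewrite gt_eqF.
rewrite -ltr_pdivlMr ?mulr_gt0 ?exprn_gt0//.
by rewrite -/delta ltr_pdivrMr.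
Unshelve. all: by end_near. Qed.
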